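(* Let $q$ be a prime power and let $\mathbb{F}_q$ be the finite field with $q$ elements. For each positive integer $n$, let $A_q(n)$ be the number of pairwise non-isomorphic directed graphs of the form $G(T/\mathbb{F}_q^n)$, where $T$ ranges over all $\mathbb{F}_q$-linear maps $T:\mathbb{F}_q^n\to\mathbb{F}_q^n$. Let $\mathcal P_n$ be the set of all nonzero vectors $\lambda=(\lambda_1,\ldots,\lambda_n)$ of nonnegative integers with $\sum_{i=1}^n \lambda_i\cdot i\le n$. For each $i\ge 1$, let $\sigma_i$ be the number of positive divisors of $q^i-1$, and let $\sigma_i^*$ be the number of positive integers $e$ such that $\mathrm{ord}_e q=i$, where $\mathrm{ord}_e q=\min\{j>0 : q^j\equiv 1 \pmod e\}$. Then $$\sum_{\lambda\in\mathcal P_n}\prod_{i=1}^n\binom{\sigma_i^*+\lambda_i-1}{\lambda_i}\le A_q(n)\le 2^{4\sqrt n}\cdot\sum_{\lambda\in\mathcal P_n}\prod_{i=1}^n\binom{\sigma_i+\lambda_i-1}{\lambda_i}.$$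
   Context: For an $\mathbb{F}_q$-linear map $T:\mathbb{F}_q^n\to\mathbb{F}_q^n$, the functional graph $G(T/\mathbb{F}_q^n)$ is the directed graph with vertex set $\mathbb{F}_q^n$ and edge set $\{v\to T(v) : v\in\mathbb{F}_q^n\}$. *)

(* Defs.v *)
(* World: MathComp + MathComp-Analysis (for real powers and asbool). *)
From HB Require Import structures.
From mathcomp Require Import all_boot all_order all_fingroup all_algebra.
From mathcomp Require Import boolp reals exp.

Set Implicit Arguments.
Unset Strict Implicit.
Unset Printing Implicit Defensive.

Import Order.TTheory GRing.Theory Num.Theory.

(* A directed graph on the finite vertex set V is given by its edge set. *)
Definition functional_graph (V : finType) (T : V -> V) : {set V * V} :=
  [set (v, T v) | v : V].

Definition digraph_iso (V : finType) (G H : {set V * V}) : bool :=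
  [exists f : {perm V}, forall x : V, forall y : V,
     ((x, y) \in G) == ((f x, f y) \in H)].

Lemma digraph_iso_equiv (V : finType) : equivalence_rel (@digraph_iso V).
Proof.
have refl G : @digraph_iso V G G.
  by apply/existsP; exists 1%g; apply/forallP=> x; apply/forallP=> y; rewrite !perm1.
have sym G H : @digraph_iso V G H -> digraph_iso H G.
  case/existsP=> f /forallP fP; apply/existsP; exists (f^-1)%g.
  apply/forallP=> x; apply/forallP=> y.
  by have /forallP/(_ ((f^-1)%g y))/eqP -> := fP ((f^-1)%g x); rewrite !permKV.
have trans G H K : @digraph_iso V G H -> digraph_iso H K -> digraph_iso G K.
  case/existsP=> f /forallP fP /existsP[g /forallP gP].
  apply/existsP; exists (f * g)%g; apply/forallP=> x; apply/forallP=> y.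
  have /forallP/(_ y)/eqP -> := fP x.
  by have /forallP/(_ (f y))/eqP -> := gP (f x); rewrite !permM.
move=> G H K; split=> // GH; apply/idP/idP => [|HK]; last exact: trans HK.
exact/trans/sym.
Qed.

Definition linear_graphs (F : finFieldType) (n : nat) :
    {set {set 'rV[F]_n * 'rV[F]_n}} :=
  [set functional_graph (T : 'rV[F]_n -> 'rV[F]_n)
    | T : {ffun 'rV[F]_n -> 'rV[F]_n} & `[< linear T >]].

(* A_q(n), for F a field with q elements: the number of isomorphism classes. *)
Definition num_linear_graphs (F : finFieldType) (n : nat) : nat :=
  #|equivalence_partition (@digraph_iso 'rV[F]_n) (linear_graphs F n)|.

(* ord_e q = i; false for every i when q is not invertible modulo e. *)
Definition is_mult_order (e q i : nat) : bool :=
  [&& 0 < i, q ^ i == 1 %[mod e] &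
      [forall j : 'I_i, (0 < j) ==> (q ^ j != 1 %[mod e])]].

Definition sigma (q i : nat) : nat := size (divisors (q ^ i - 1)).

(* The bound e < q ^ i loses no e when q > 1: see is_mult_order_lt. *)
Definition sigma_star (q i : nat) : nat :=
  #|[set e : 'I_(q ^ i) | (0 < e) && is_mult_order e q i]|.

Lemma is_mult_order_lt (q i e : nat) :
  1 < q -> is_mult_order e q i -> e < q ^ i.
Proof.
move=> q1 /and3P[i0]; have q0 : 0 < q ^ i by rewrite expn_gt0 ltnW.
rewrite eqn_mod_dvd // => /dvdn_leq le_e _.
rewrite -(subnK q0) addn1 ltnS le_e // subn_gt0.
by rewrite -(exp1n i) ltn_exp2r.
Qed.

(* The set P_n.  The entry lambda_(i+1) is stored at index i : 'I_n; entries
   are bounded by n, which the constraint forces anyway: see weight_le. *)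
Definition weight_vectors (n : nat) : {set {ffun 'I_n -> 'I_n.+1}} :=
  [set l : {ffun 'I_n -> 'I_n.+1} |
    [exists i, (l i : nat) != 0] && (\sum_(i < n) l i * i.+1 <= n)].

Lemma weight_le (n : nat) (l : 'I_n -> nat) (i : 'I_n) :
  \sum_(j < n) l j * j.+1 <= n -> l i <= n.
Proof.
apply: leq_trans; rewrite (bigD1 i) //=.
by apply: leq_trans (leq_addr _ _); rewrite leq_pmulr.
Qed.

(* Main.v *)
(* A linear map acts bijectively on its eventual image and nilpotently on a
   complement, so its graph is controlled by the ranks of the powers of T and
   by the dimensions of the kernels of T^k - 1, and these numbers determine it
   up to isomorphism: an isomorphism is built greedily, first cycle by cycle
   and then by matching preimages of equal height.

   Lower bound: for each e with ord_e q = i, multiplication by an element of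
   order e of the field with q^i elements is a block of size i all of whose
   nonzero vectors have period e.  The number of points fixed by T^k for a
   direct sum of such blocks and a zero block determines, by induction on k,
   how many blocks of each order occur.

   Upper bound: for e prime to q the kernels of the powers of Phi_e(T) grow by
   nonincreasing multiples of d = ord_e q, since a cyclic group of order e acts
   freely on the nonzero vectors of each increment.  The second differences of
   their dimensions are multiplicities of pairs (d k, e), in which e divides
   q^(d k) - 1, and together with the second differences for the powers of T,
   which form a partition, they determine the graph.  The partition factor is
   bounded by Erdos' induction on m p(m) = sum_(j, k) k p(m - j k), which gives
   p(m) <= exp (8/3 sqrt m). *)
Require Import Defs.
From HB Require Import structures.
From mathcomp Require Import all_boot all_order all_fingroup all_algebra.
From mathcomp Require Import all_solvable all_field mxabelem.
From mathcomp Require Import boolp reals sequences exp.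
From mathcomp Require Import ring lra zify.

Set Implicit Arguments.
Unset Strict Implicit.
Unset Printing Implicit Defensive.

Import Order.TTheory GRing.Theory Num.Theory.

(** * Conjugacy of self-maps of a finite set *)

Definition in_iter_image (V : finType) (f : V -> V) (j : nat) (v : V) : bool :=
  [exists u, iter j f u == v].

Section PartialConjugacy.

Variable V : finType.
Implicit Types (f g : V -> V) (R : {set V * V}).

Lemma in_iter_imageS f j v : in_iter_image f j v -> in_iter_image f j.+1 (f v).
Proof. by case/existsP=> u /eqP <-; apply/existsP; exists u. Qed.

Lemma in_iter_image_pred f j v : in_iter_image f j.+1 v -> in_iter_image f j v.
Proof. by case/existsP=> u /eqP <-; apply/existsP; exists (f u); rewrite -iterSr. Qed.

Lemma periodic_in_iter_image f k j v :
  0 < k -> iter k f v = v -> in_iter_image f j v.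
Proof.
move=> k0 kv; have iterM m : iter (m * k) f v = v.
  by elim: m => // m IH; rewrite mulSn iterD IH.
apply/existsP; exists (iter (j * k - j) f v).
by rewrite -iterD subnKC ?iterM // leq_pmulr.
Qed.

Lemma iter_eq_period f k v :
    0 < k -> iter k f v = v -> (forall d, 0 < d < k -> iter d f v <> v) ->
  forall a b, a < k -> b < k -> (iter a f v == iter b f v) = (a == b).
Proof.
move=> k0 kv mink a b.
wlog lab : a b / a <= b => [wl ak bk|ak bk].
  by case/orP: (leq_total a b) => lab; [|rewrite eq_sym [in RHS]eq_sym]; apply: wl.
apply/eqP/eqP => [eab|-> //]; apply/eqP; rewrite eqn_leq lab leqNgt.
apply/negP=> ltab; apply: (mink (b - a)); first lia.
rewrite -{2}kv -[in RHS](subnK (ltnW ak)) iterD eab -iterD.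
have -> : k - a + b = b - a + k by lia.
by rewrite iterD kv.
Qed.

(* R is the graph of a partial isomorphism from f to g, closed under both maps,
   that preserves heights: the height of v is the largest j with v in the image
   of the j-th iterate. *)
Definition partial_conj f g R :=
  [/\ forall p p', p \in R -> p' \in R -> (p.1 == p'.1) = (p.2 == p'.2),
      forall p, p \in R -> (f p.1, g p.2) \in R
    & forall p j, p \in R -> in_iter_image f j p.1 = in_iter_image g j p.2].

Lemma partial_conj_iter f g R p k :
  partial_conj f g R -> p \in R -> (iter k f p.1, iter k g p.2) \in R.
Proof. by case=> _ cl _ pR; elim: k => [|k /cl//]; rewrite -surjective_pairing. Qed.

(* By injectivity of both projections of R, a predicate transported by R cuts
   the domain and the range of R in equally many points, so a point outside the
   domain forces one outside the range. *)
Lemma partial_conj_transfer f g R (S S' : {set V}) v :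
    partial_conj f g R -> #|S| = #|S'| ->
    (forall p, p \in R -> (p.1 \in S) = (p.2 \in S')) ->
    v \in S -> v \notin [set p.1 | p in R] ->
  exists2 v', v' \in S' & v' \notin [set p.2 | p in R].
Proof.
case=> inj _ _ eqS RS vS vR.
have e1 : #|S :&: [set p.1 | p in R]| = #|[set p in R | p.1 \in S]|.
  rewrite -(@card_in_imset _ _ (fun p : V * V => p.1)).
    apply: eq_card => x; rewrite inE; apply/andP/imsetP => [[xS /imsetP[p pR xp]]|[p]].
      by exists p; rewrite // inE pR -xp.
    by rewrite inE => /andP[pR pS] ->; split=> //; apply: imset_f.
  move=> p p'; rewrite !inE => /andP[pR _] /andP[p'R _] /eqP e.
  move: (e); rewrite inj // => /eqP e2.
  by rewrite [p]surjective_pairing (eqP e) e2 -surjective_pairing.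
have e2 : #|S' :&: [set p.2 | p in R]| = #|[set p in R | p.1 \in S]|.
  rewrite -(@card_in_imset _ _ (fun p : V * V => p.2)).
    apply: eq_card => x; rewrite inE; apply/andP/imsetP => [[xS /imsetP[p pR xp]]|[p]].
      by exists p; rewrite // inE pR RS // -xp.
    by rewrite inE => /andP[pR pS] ->; split; [rewrite -RS | apply: imset_f].
  move=> p p'; rewrite !inE => /andP[pR _] /andP[p'R _] /eqP e.
  move: (e); rewrite -inj // => /eqP e2.
  by rewrite [p]surjective_pairing (eqP e) e2 -surjective_pairing.
have /card_gt0P[v'] : 0 < #|S' :\: [set p.2 | p in R]|.
  rewrite -(ltn_add2l #|S' :&: [set p.2 | p in R]|) addn0 cardsID -eqS e2 -e1.
  rewrite -(cardsID [set p.1 | p in R] S) -{1}[#|_ :&: _|]addn0 ltn_add2l.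
  by apply/card_gt0P; exists v; rewrite inE vR.
by rewrite inE => /andP[? ?]; exists v'.
Qed.

Definition swap_pairs R := [set (p.2, p.1) | p in R].

Lemma mem_swap_pairs R p : (p \in swap_pairs R) = ((p.2, p.1) \in R).
Proof.
apply/imsetP/idP => [[[x y] ? ->] //|pR]; exists (p.2, p.1) => //=.
by rewrite -surjective_pairing.
Qed.

Lemma partial_conj_swap f g R : partial_conj f g R -> partial_conj g f (swap_pairs R).
Proof.
case=> inj cl ht; split=> [p p'|p|p j]; rewrite !mem_swap_pairs.
- by move=> pR p'R; rewrite -(inj _ _ pR p'R).
- by move/cl.
- by move/ht=> ->.
Qed.

Lemma dom_swap_pairs R : [set p.1 | p in swap_pairs R] = [set p.2 | p in R].
Proof.
apply/setP=> x; apply/imsetP/imsetP => -[p pR ->].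
  by exists (p.2, p.1); rewrite // -mem_swap_pairs.
by exists (p.2, p.1); rewrite // mem_swap_pairs -surjective_pairing.
Qed.

Lemma ran_swap_pairs R : [set p.2 | p in swap_pairs R] = [set p.1 | p in R].
Proof.
apply/setP=> x; apply/imsetP/imsetP => -[p pR ->].
  by exists (p.2, p.1); rewrite // -mem_swap_pairs.
by exists (p.2, p.1); rewrite // mem_swap_pairs -surjective_pairing.
Qed.

Variables f g : V -> V.
Hypothesis eq_fix : forall k, 0 < k ->
  #|[set v | iter k f v == v]| = #|[set v | iter k g v == v]|.

(* The smallest period k of a periodic point missed on either side also occurs on
   the other side, by counting points fixed by the k-th iterates. *)
Lemma partial_conj_add_cycle R v :
    partial_conj f g R -> v \notin [set p.1 | p in R] ->
    (exists2 k, 0 < k & iter k f v = v) ->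
  exists R', partial_conj f g R' /\ #|R| < #|R'|.
Proof.
move=> cR vR [k0 k00 k0v].
pose bad k := (0 < k) &&
  ([exists u, (u \notin [set p.1 | p in R]) && (iter k f u == u)]
  || [exists u, (u \notin [set p.2 | p in R]) && (iter k g u == u)]).
have exbad : exists k, bad k.
  by exists k0; rewrite /bad k00; apply/orP; left; apply/existsP; exists v; rewrite vR k0v eqxx.
case: (ex_minnP exbad) => k /andP[k_gt0 kbad] mink.
have [inj cl ht] := cR.
have tr p : p \in R -> (iter k f p.1 == p.1) = (iter k g p.2 == p.2).
  by move=> pR; have := inj _ _ (partial_conj_iter k cR pR) pR.
have [u [u' [uR ku u'R ku']]] : exists u u', [/\ u \notin [set p.1 | p in R],
    iter k f u = u, u' \notin [set p.2 | p in R] & iter k g u' = u'].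
  case/orP: kbad => /existsP[u /andP[uR ku]].
    have [||u'] := partial_conj_transfer cR (eq_fix k_gt0) _ _ uR.
    - by move=> p pR; rewrite !inE tr.
    - by rewrite inE.
    by rewrite inE => /eqP ku' u'R; exists u, u'; split=> //; apply/eqP.
  rewrite -dom_swap_pairs in uR.
  have [||u'] := partial_conj_transfer (partial_conj_swap cR) (esym (eq_fix k_gt0)) _ _ uR.
  - by move=> p; rewrite mem_swap_pairs !inE => pR; rewrite -(tr _ pR).
  - by rewrite inE.
  rewrite inE ran_swap_pairs => /eqP ku' u'R; rewrite dom_swap_pairs in uR.
  by exists u', u; split=> //; apply/eqP.
have minf d : 0 < d < k -> iter d f u <> u.
  case/andP=> d0 dk du; have := mink d; rewrite leqNgt dk; case/(_ _)/negP => //.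
  by rewrite /bad d0; apply/orP; left; apply/existsP; exists u; rewrite uR du eqxx.
have ming d : 0 < d < k -> iter d g u' <> u'.
  case/andP=> d0 dk du; have := mink d; rewrite leqNgt dk; case/(_ _)/negP => //.
  by rewrite /bad d0; apply/orP; right; apply/existsP; exists u'; rewrite u'R du eqxx.
pose C := [set (iter (i : 'I_k) f u, iter i g u') | i : 'I_k].
have outf p i : p \in R -> i < k -> p.1 == iter i f u = false.
  move=> pR ik; apply/negP=> /eqP e; case/negP: uR; apply/imsetP.
  exists (iter (k - i) f p.1, iter (k - i) g p.2); first exact: partial_conj_iter.
  by rewrite /= e -iterD subnK ?ku // ltnW.
have outg p i : p \in R -> i < k -> p.2 == iter i g u' = false.
  move=> pR ik; apply/negP=> /eqP e; case/negP: u'R; apply/imsetP.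
  exists (iter (k - i) f p.1, iter (k - i) g p.2); first exact: partial_conj_iter.
  by rewrite /= e -iterD subnK ?ku' // ltnW.
exists (R :|: C); split; last first.
  apply: proper_card; apply/properP; split; first exact: subsetUl.
  exists (u, u'); first by rewrite inE; apply/orP; right; apply/imsetP; exists (Ordinal k_gt0).
  by apply: contra uR => uR; apply/imsetP; exists (u, u').
split=> [p p'|p|p j].
- rewrite !inE => /orP[pR|/imsetP[i _ ->]] /orP[p'R|/imsetP[i' _ ->]] /=.
  + exact: inj.
  + by rewrite outf ?outg.
  + by rewrite eq_sym outf // eq_sym outg.
  + by rewrite (iter_eq_period k_gt0 ku minf) // (iter_eq_period k_gt0 ku' ming).
- rewrite !inE => /orP[/cl -> //|/imsetP[i _ ->]] /=; apply/orP; right; apply/imsetP.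
  have [ik|ik] := ltnP i.+1 k; first by exists (Ordinal ik).
  have ei : i.+1 = k by have := ltn_ord i; lia.
  by exists (Ordinal k_gt0); rewrite //= -!iterS ei ku ku'.
- rewrite inE => /orP[/ht //|/imsetP[i _ ->]] /=.
  rewrite !(@periodic_in_iter_image _ k) //.
    by rewrite -iterD addnC iterD ku'.
  by rewrite -iterD addnC iterD ku.
Qed.

(* A preimage of a point of the domain is matched with one of the same height. *)
Lemma partial_conj_add_leaf R v :
    (forall j w w', in_iter_image f j.+1 w -> in_iter_image g j.+1 w' ->
       #|[set u | (f u == w) && in_iter_image f j u]|
         = #|[set u | (g u == w') && in_iter_image g j u]|) ->
    partial_conj f g R -> v \notin [set p.1 | p in R] ->
    f v \in [set p.1 | p in R] -> (exists j, ~~ in_iter_image f j v) ->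
  exists R', partial_conj f g R' /\ #|R| < #|R'|.
Proof.
move=> eq_pre cR vR /imsetP[[w w'] wR /= fv] exj; have [inj cl ht] := cR.
case: (ex_minnP exj) => -[|h].
  by case/existsP; exists v.
move=> vhS minh; have vh : in_iter_image f h v.
  by apply: contraT => /minh; rewrite ltnn.
pose pre F z j := [set u | (F u == z) && in_iter_image F j u] : {set V}.
have card_pre_diff F z : #|pre F z h :\: pre F z h.+1| = #|pre F z h| - #|pre F z h.+1|.
  rewrite cardsD; congr (_ - #|pred_of_set _|); apply/setIidPr/subsetP=> u.
  by rewrite !inE => /andP[-> /in_iter_image_pred ->].
have pre0 F z j : ~~ in_iter_image F j.+1 z -> #|pre F z j| = 0.
  move=> zj; apply: eq_card0 => u; rewrite !inE; apply/negP=> /andP[/eqP e uj].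
  by case/negP: zj; rewrite -e; apply: in_iter_imageS.
have eqw j : in_iter_image f j w = in_iter_image g j w' by exact: (ht (w, w')).
have eqS : #|pre f w h :\: pre f w h.+1| = #|pre g w' h :\: pre g w' h.+1|.
  rewrite !card_pre_diff; congr (_ - _); last first.
    case: (boolP (in_iter_image f h.+2 w)) => wh; first by apply: eq_pre; rewrite -?eqw.
    by rewrite !pre0 -?eqw.
  by apply: eq_pre; rewrite -?eqw -fv; apply: in_iter_imageS.
have [||v'] := partial_conj_transfer cR eqS _ _ vR.
- move=> p pR; rewrite !inE !(ht _ _ pR).
  by have /= -> := inj _ _ (cl _ pR) wR.
- by rewrite !inE fv eqxx vh (negPf vhS).
rewrite !inE => /andP[v'n /andP[/eqP gv' v'h]] v'R.
have {v'n} v'hS : ~~ in_iter_image g h.+1 v' by move: v'n; rewrite gv' eqxx.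
have anti (F : V -> V) x j : in_iter_image F h x -> ~~ in_iter_image F h.+1 x ->
    in_iter_image F j x = (j <= h).
  have mono i m : in_iter_image F (m + i) x -> in_iter_image F i x.
    by elim: m => // m IH /in_iter_image_pred.
  move=> xh xhS; have [jh|jh] := leqP j h.
    by apply: (mono _ (h - j)); rewrite subnK.
  by apply: contraNF xhS; rewrite -(subnK jh) => /mono.
exists ((v, v') |: R); split; last first.
  rewrite cardsU1; suff -> : (v, v') \notin R by rewrite ltnS.
  by apply: contra vR => vR; apply/imsetP; exists (v, v').
have outf p : p \in R -> p.1 == v = false.
  by move=> pR; apply: contraNF vR => /eqP <-; apply: imset_f.
have outg p : p \in R -> p.2 == v' = false.
  by move=> pR; apply: contraNF v'R => /eqP <-; apply: imset_f.
split=> [p p'|p|p j].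
- rewrite !inE => /orP[/eqP->|pR] /orP[/eqP->|p'R] /=.
  + by rewrite !eqxx.
  + by rewrite eq_sym outf // eq_sym outg.
  + by rewrite outf // outg.
  + exact: inj.
- rewrite !inE => /orP[/eqP->|/cl ->]; last by rewrite orbT.
  by apply/orP; right; rewrite fv gv'.
- rewrite !inE => /orP[/eqP->|/ht //] /=.
  by rewrite (anti f v j vh vhS) (anti g v' j v'h v'hS).
Qed.

Theorem functions_conjugate N :
    (forall v, in_iter_image f N v -> exists2 k, 0 < k & iter k f v = v) ->
    (forall j w w', in_iter_image f j.+1 w -> in_iter_image g j.+1 w' ->
       #|[set u | (f u == w) && in_iter_image f j u]|
         = #|[set u | (g u == w') && in_iter_image g j u]|) ->
  exists s : {perm V}, forall v, s (f v) = g (s v).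
Proof.
move=> perN eq_pre.
have ext R : partial_conj f g R -> [set p.1 | p in R] != setT ->
    exists R', partial_conj f g R' /\ #|R| < #|R'|.
  move=> cR; rewrite -properT => /properP[_ [v _ vR]].
  have [[u uR per]|noper] := pselect (exists2 u, u \notin [set p.1 | p in R] &
                                    exists2 k, 0 < k & iter k f u = u).
    exact: partial_conj_add_cycle uR per.
  have per_in u : (exists2 k, 0 < k & iter k f u = u) -> u \in [set p.1 | p in R].
    by move=> per; apply: contraT => uR; case: noper; exists u.
  have exj : exists j, iter j f v \in [set p.1 | p in R].
    by exists N; apply/per_in/perN/existsP; exists v.
  case: (ex_minnP exj) => -[|j] jR minj; first by rewrite jR in vR.
  have jnR : iter j f v \notin [set p.1 | p in R].
    by apply: contraT; rewrite negbK => /minj; rewrite ltnn.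
  apply: (partial_conj_add_leaf eq_pre cR jnR jR).
  by exists N; apply: contra jnR => /perN/per_in.
have [R cR domR] : exists2 R, partial_conj f g R & [set p.1 | p in R] = setT.
  have : partial_conj f g set0 by split=> [p p'|p|p j]; rewrite inE.
  move: set0 => R; have [m] := ubnP (#|{: V * V}| - #|R|).
  elim: m R => // m IH R leR cR.
  have [domR|/(ext R cR)[R' [cR' ltR]]] := eqVneq [set p.1 | p in R] setT; first by exists R.
  have leR' : #|R'| <= #|{: V * V}| by apply: max_card.
  by apply: IH cR'; lia.
have [inj cl _] := cR.
pose s v := odflt v (omap snd [pick p in R | p.1 == v]).
have sP v : (v, s v) \in R.
  rewrite /s; case: pickP => [[x y] /andP[pR /= /eqP <-] //|no].
  have : v \in [set p.1 | p in R] by rewrite domR inE.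
  by case/imsetP=> p pR e; have /negP[] := negbT (no p); apply/andP; rewrite -e.
have s_inj : injective s.
  by move=> x y e; apply/eqP; rewrite (inj _ _ (sP x) (sP y)) /= e.
exists (perm s_inj) => v; rewrite !permE; apply/eqP.
by rewrite -(inj _ _ (sP (f v)) (cl _ (sP v))) /=.
Qed.

End PartialConjugacy.

(** * Counting multisets *)

Section CountMultisets.

Variables (J : finType) (n : nat).

Definition multisets (E : {set J}) (l : nat) : {set {ffun J -> 'I_n.+1}} :=
  [set g : {ffun J -> 'I_n.+1} |
    (\sum_j g j == l) && [forall j, (j \notin E) ==> (g j == ord0)]].

Lemma card_multisets (E : {set J}) (l : nat) :
  l <= n -> #|multisets E l| = 'C(#|E| + l - 1, l).
Proof.
move=> ln; case cE : #|E| => [|m].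
  have E0 : E = set0 by apply: cards0_eq.
  have all0 g : g \in multisets E l -> forall j, g j = ord0.
    by rewrite inE => /andP[_ /forallP gE] j; have := gE j; rewrite E0 inE => /eqP.
  case: l ln all0 => [|l] ln all0.
    rewrite add0n bin0 -(cards1 ([ffun=> ord0] : {ffun J -> 'I_n.+1})); apply: eq_card => g.
    rewrite in_set1; apply/idP/eqP => [gM|->]; first by apply/ffunP=> j; rewrite ffunE all0.
    rewrite inE big1 ?eqxx /=; last by move=> j _; rewrite ffunE.
    by apply/forallP=> j; rewrite ffunE eqxx implybT.
  rewrite bin_small; last by lia.
  apply: eq_card0 => g; apply/negP=> gM; move: (gM); rewrite inE big1; last first.
    by move=> j _; rewrite all0.
  by [].
rewrite addSn subn1 /= -bin_sub ?leq_addl // addnK -card_ord_partitions.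
pose h (t : m.+1.-tuple 'I_l.+1) : {ffun J -> 'I_n.+1} :=
  [ffun j => if j \in E then inord (nth ord0 t (index j (enum E))) else ord0].
have szE : size (enum E) = m.+1 by rewrite -cardE.
have [j0 _] : exists j, j \in E by apply/card_gt0P; rewrite cE.
have nthle (t : m.+1.-tuple 'I_l.+1) i : (nth ord0 t i : nat) < n.+1.
  by rewrite (leq_trans (ltn_ord _)).
have hE t i : i < m.+1 -> h t (nth j0 (enum E) i) = nth ord0 t i :> nat.
  move=> im; rewrite ffunE -(mem_enum E) mem_nth ?szE // index_uniq ?szE ?enum_uniq //.
  by rewrite inordK.
have h_inj : injective h.
  move=> t t' /ffunP e; apply/val_inj/(@eq_from_nth _ ord0); rewrite !size_tuple //.
  by move=> i im; apply: val_inj; have := congr1 val (e (nth j0 (enum E) i)); rewrite /= !hE.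
have sum_enum (g : {ffun J -> 'I_n.+1}) : (forall j, j \notin E -> g j = ord0) ->
    \sum_j g j = \sum_(i < m.+1) g (nth j0 (enum E) i).
  move=> g0; rewrite (bigID [in E]) /= [X in _ + X]big1 ?addn0; last by move=> j /g0->.
  by rewrite -big_enum (big_nth j0) szE big_mkord.
rewrite -(card_imset _ h_inj); apply: eq_card => g; apply/idP/imsetP.
  rewrite inE => /andP[/eqP gl /forallP g0].
  have szg : size [seq (inord (g j) : 'I_l.+1) | j <- enum E] == m.+1.
    by rewrite size_map szE.
  have gle j : g j < l.+1 by rewrite ltnS -gl (bigD1 j) //= leq_addr.
  have {}g0 j : j \notin E -> g j = ord0 by move=> jE; have := g0 j; rewrite jE => /eqP.
  exists (Tuple szg).
    rewrite inE (big_nth ord0) big_mkord size_tuple.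
    apply/eqP; rewrite -[RHS]gl sum_enum //; apply: eq_bigr => i _; rewrite (nth_map j0) ?szE //.
    by rewrite inordK.
  apply/ffunP=> j; apply: val_inj; rewrite ffunE; case: ifPn => [jE|/g0 -> //].
  by rewrite /= (nth_map j0) ?index_mem ?mem_enum // nth_index ?mem_enum // inordK inordK.
case=> t; rewrite inE => /eqP tl ->; rewrite inE sum_enum; last first.
  by move=> j /negPf jE; rewrite ffunE jE.
apply/andP; split; last by apply/forallP=> j; apply/implyP=> /negPf jE; rewrite ffunE jE.
rewrite -[X in _ == X]tl (big_nth ord0) big_mkord size_tuple; apply/eqP/eq_bigr=> i _.
by rewrite hE.
Qed.

Definition supported (E : 'I_n -> {set J}) (D : {ffun 'I_n -> {ffun J -> 'I_n.+1}}) : bool :=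
  [forall i, forall j, (j \notin E i) ==> (D i j == ord0)].

Definition weight (D : {ffun 'I_n -> {ffun J -> 'I_n.+1}}) : nat :=
  \sum_(i < n) \sum_j D i j * i.+1.

Definition nonzero_supported (E : 'I_n -> {set J}) : {set {ffun 'I_n -> {ffun J -> 'I_n.+1}}} :=
  [set D | [&& supported E D, 0 < weight D & weight D <= n]].

Lemma sum_weight_vectors (E : 'I_n -> {set J}) :
  \sum_(l in weight_vectors n) \prod_(i < n) 'C(#|E i| + l i - 1, l i)
    = #|nonzero_supported E|.
Proof.
pose rows (D : {ffun 'I_n -> {ffun J -> 'I_n.+1}}) : {ffun 'I_n -> 'I_n.+1} :=
  [ffun i => inord (\sum_j D i j)].
have weightE D : weight D = \sum_(i < n) (\sum_j D i j) * i.+1.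
  by apply: eq_bigr => i _; rewrite big_distrl.
have rowsE D i : weight D <= n -> rows D i = \sum_j D i j :> nat.
  rewrite weightE => wD; rewrite ffunE inordK // ltnS.
  exact: (@weight_le n (fun i => \sum_j D i j) i wD).
rewrite -sum1_card (partition_big rows (mem (weight_vectors n))) /=; last first.
  move=> D; rewrite !inE => /and3P[_ w0 wn]; apply/andP; split; last first.
    by apply: (leq_trans _ wn); rewrite weightE; apply: leq_sum => i _; rewrite rowsE //.
  apply: contraLR w0; rewrite negb_exists => /forallP r0; rewrite -leqNgt leqn0 weightE.
  by apply/eqP/big1=> i _; have := r0 i; rewrite negbK rowsE // => /eqP ->.
apply: eq_bigr => l lP; rewrite sum1dep_card.
have lw : \sum_(i < n) l i * i.+1 <= n by move: lP; rewrite inE => /andP[].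
have l0 : 0 < \sum_(i < n) l i * i.+1.
  move: lP; rewrite inE => /andP[/existsP[i li] _].
  by rewrite (bigD1 i) //= addn_gt0 muln_gt0 lt0n li.
transitivity #|family (fun i => mem (multisets (E i) (l i)))|; last first.
  apply: eq_card => D; rewrite !inE; apply/familyP/andP => [fD|[/and3P[sD w0 wn] /eqP rD] i].
    have rD i : \sum_j D i j = l i by have := fD i; rewrite inE => /andP[/eqP].
    have wD : weight D = \sum_(i < n) l i * i.+1.
      by rewrite weightE; apply: eq_bigr => i _; rewrite rD.
    rewrite wD l0 lw andbT; split; last first.
      by apply/eqP/ffunP=> i; apply: val_inj; rewrite /= rowsE ?wD ?rD.
    by apply/andP; split=> //; apply/forallP=> i; have := fD i; rewrite inE => /andP[].
  by rewrite inE -rowsE // rD eqxx; apply: (forallP sD).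
rewrite card_family foldrE big_map big_enum; apply: eq_bigr => i _.
by rewrite -card_multisets // -ltnS.
Qed.

End CountMultisets.

(** * Partitions *)

Section Partitions.

Variable n : nat.

(* A partition of m, given by its multiplicities: l i parts equal to i + 1. *)
Definition partitions_of (m : nat) : {set {ffun 'I_n -> 'I_n.+1}} :=
  [set l : {ffun 'I_n -> 'I_n.+1} | \sum_(i < n) l i * i.+1 == m].

Lemma card_partitions_remove_parts (m j : nat) (i : 'I_n) :
  #|[set l in partitions_of m | j <= (l : {ffun 'I_n -> 'I_n.+1}) i]|
    <= (j * i.+1 <= m) * #|partitions_of (m - j * i.+1)|.
Proof.
have split_sum (l : 'I_n -> nat) :
    \sum_(k < n) l k * k.+1 = l i * i.+1 + \sum_(k < n | k != i) l k * k.+1.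
  by rewrite (bigD1 i).
have [jm|jm] := leqP (j * i.+1) m; last first.
  rewrite mul0n leqn0; apply/eqP/eq_card0=> l; rewrite !inE.
  apply/negP=> /andP[/eqP lm jl]; move: jm; rewrite ltnNge => /negP; apply.
  by rewrite -lm split_sum (leq_trans _ (leq_addr _ _)) // leq_mul.
pose sub (l : {ffun 'I_n -> 'I_n.+1}) : {ffun 'I_n -> 'I_n.+1} :=
  [ffun k => if k == i then inord (l k - j) else l k].
have subi l : sub l i = l i - j :> nat.
  by rewrite ffunE eqxx inordK // ltnS (leq_trans (leq_subr _ _)) // -ltnS.
have subk l k : k != i -> sub l k = l k by move=> /negPf ki; rewrite ffunE ki.
rewrite mul1n -(@card_in_imset _ _ sub); last first.
  move=> l l'; rewrite !inE => /andP[_ jl] /andP[_ jl'] e; apply/ffunP=> k.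
  have [->|ki] := eqVneq k i; last by rewrite -(subk l) // e subk.
  by apply/val_inj; move: (subi l); rewrite e subi /=; lia.
apply/subset_leq_card/subsetP=> l' /imsetP[l lP ->].
move: lP; rewrite !inE => /andP[/eqP lm jl].
have e : \sum_(k < n | k != i) sub l k * k.+1 = \sum_(k < n | k != i) l k * k.+1.
  by apply: eq_bigr => k ki; rewrite subk.
rewrite (split_sum (fun k => sub l k)) subi e mulnBl -lm (split_sum (fun k => l k)).
by rewrite addnBAC // leq_mul.
Qed.

Lemma partitions_recursion (m : nat) :
  m * #|partitions_of m| <=
    \sum_(1 <= j < n.+1) \sum_(i < n | j * i.+1 <= m)
      i.+1 * #|partitions_of (m - j * i.+1)|.
Proof.
have -> : m * #|partitions_of m| =
    \sum_(1 <= j < n.+1) \sum_(i < n)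
      i.+1 * #|[set l in partitions_of m | j <= (l : {ffun 'I_n -> 'I_n.+1}) i]|.
  rewrite mulnC -sum_nat_const exchange_big /=.
  transitivity (\sum_(l in partitions_of m) \sum_(i < n) l i * i.+1).
    by apply: eq_bigr => l; rewrite inE => /eqP ->.
  rewrite exchange_big /=; apply: eq_bigr => i _.
  rewrite -big_distrl /= mulnC -big_distrr /=; congr (_ * _).
  under [RHS]eq_bigr do rewrite -sum1dep_card big_mkcondr.
  rewrite exchange_big /=; apply: eq_bigr => l _.
  rewrite -big_mkcond /= big_geq_mkord /= sum1dep_card.
  rewrite -[LHS](card_ord (l i)).
  have inj : injective (fun k : 'I_(l i) => inord k.+1 : 'I_n.+1).
    have ltn (a : 'I_(l i)) : a.+1 < n.+1 by rewrite ltnS (leq_trans (ltn_ord a)) // -ltnS.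
    by move=> a b /(congr1 val); rewrite /= !inordK // => -[]; apply: val_inj.
  rewrite -(card_image inj); apply: eq_card => k; apply/imageP/idP.
    case=> a _ ->; have := ltn_ord a; have := ltn_ord (l i); move=> h1 h2.
    by rewrite inE inordK; lia.
  rewrite inE => /andP[k0 kl]; have kp : k.-1 < l i by lia.
  by exists (Ordinal kp) => //=; apply: val_inj; rewrite /= inordK ?prednK.
apply: leq_sum => j _; rewrite [X in _ <= X]big_mkcond; apply: leq_sum => i _.
have := card_partitions_remove_parts m j i.
case: (j * i.+1 <= m); rewrite ?mul0n ?mul1n; first by move=> h; rewrite leq_mul2l h.
by rewrite leqn0 => /eqP ->; rewrite muln0.
Qed.

End Partitions.

Section Analytic.
Variable R : realType.
Local Open Scope ring_scope.
Implicit Types u v x z : R.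

Lemma expR_sub_expRN_ge v : 0 <= v -> 2 * v <= expR v - expR (- v).
Proof.
move=> v0.
have small x : 0 <= x -> 2 * x - x ^+ 2 <= expR x - expR (- x).
  move=> x0; have e1 := expR_ge1Dx x; rewrite expRN.
  have le : (expR x)^-1 <= (1 + x)^-1 by rewrite lef_pV2 ?posrE ?expR_gt0 //; lra.
  apply: (le_trans _ (lerB e1 le)).
  have : (1 + x)^-1 <= 1 - x + x ^+ 2.
    rewrite -(ler_pM2r (_ : 0 < 1 + x)); last lra.
    rewrite mulVf; last by apply: lt0r_neq0; lra.
    have : 0 <= x ^+ 3 by rewrite exprn_ge0.
    by rewrite !exprS expr0; lra.
  lra.
have dbl x : 0 <= x -> 2 * (expR x - expR (- x)) <= expR (2 * x) - expR (- (2 * x)).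
  move=> x0; have -> : 2 * x = x + x by ring.
  rewrite opprD !expRD !expRN; set y := expR x; have y1 : 1 <= y by have := expR_ge1Dx x; rewrite -/y; lra.
  have y0 : y != 0 by apply: lt0r_neq0; lra.
  have yV : y * y^-1 = 1 by rewrite mulfV.
  have yV1 : y^-1 <= 1 by rewrite invf_le1 //; lra.
  have yV0 : 0 < y^-1 by rewrite invr_gt0; lra.
  have -> : y * y - y^-1 * y^-1 = (y - y^-1) * (y + y^-1) by ring.
  rewrite [leLHS]mulrC ler_wpM2l //; first lra.
  have : 0 <= (y - 1) ^+ 2 * y^-1 by rewrite mulr_ge0 ?sqr_ge0 // ltW.
  suff -> : (y - 1) ^+ 2 * y^-1 = y + y^-1 - 2 by lra.
  have -> : (y - 1) ^+ 2 * y^-1 = (y * y^-1) * y - 2 * (y * y^-1) + y^-1 by ring.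
  by rewrite yV; ring.
have iter m x : 0 <= x -> 2 ^+ m * (expR x - expR (- x)) <=
    expR (2 ^+ m * x) - expR (- (2 ^+ m * x)).
  elim: m x => [|m IH] x x0; first by rewrite !expr0 !mul1r.
  rewrite exprSr -!mulrA; apply: le_trans (IH _ _); last by rewrite mulr_ge0.
  by rewrite ler_wpM2l ?exprn_ge0 // dbl.
rewrite leNgt; apply/negP=> lt2v; set s := _ - _ in lt2v.
pose m := Num.bound (v ^+ 2 / (2 * v - s)).
have hm : v ^+ 2 / (2 * v - s) < 2 ^+ m.
  apply: lt_trans (archi_boundP _) _; first by rewrite divr_ge0 ?sqr_ge0 //; lra.
  by rewrite -natrX ltr_nat ltn_expl.
have p0 : 0 < 2 ^+ m :> R by rewrite exprn_gt0.
have := iter m (v / 2 ^+ m); rewrite [_ * (v / _)]mulrC mulfVK ?gt_eqF // -/s.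
have v2 : 0 <= v / 2 ^+ m by rewrite divr_ge0 // ltW.
move=> /(_ v2); have := small _ v2 => /(ler_wpM2l (ltW p0)) h1 h2.
have := le_trans h1 h2; rewrite mulrBr.
have -> : 2 ^+ m * (2 * (v / 2 ^+ m)) = 2 * v by field; rewrite ?gt_eqF.
have -> : 2 ^+ m * (v / 2 ^+ m) ^+ 2 = v ^+ 2 / 2 ^+ m by field; rewrite ?gt_eqF.
move: hm; rewrite ltr_pdivrMr; last lra.
rewrite mulrC -ltr_pdivrMr //; lra.
Qed.

Lemma expRN_div_sqr_le u : 0 < u -> expR (- u) / (1 - expR (- u)) ^+ 2 <= u ^- 2.
Proof.
move=> u0; have h := @expR_sub_expRN_ge (u / 2) ltac:(lra).
have e1 : expR (- u) < 1 by rewrite expR_lt1; lra.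
rewrite ler_pdivrMr ?exprn_gt0 ?subr_gt0 // mulrC ler_pdivlMr ?exprn_gt0 //.
have eu : expR (- u) = expR (- (u / 2)) ^+ 2 by rewrite expr2 -expRD; congr expR; lra.
rewrite {1}eu -exprMn ler_sqr ?nnegrE; last 2 first.
- by rewrite mulr_ge0 ?expR_ge0 // ltW.
- by rewrite subr_ge0 ltW.
have e2 : 1 - expR (- u) = expR (- (u / 2)) * (expR (u / 2) - expR (- (u / 2))).
  by rewrite mulrBr -!expRD addNr expR0; congr (_ - expR _); lra.
by rewrite e2 ler_wpM2l ?expR_ge0 //; lra.
Qed.

Lemma sum_nat_mul_exp_le (n : nat) z : 0 <= z -> z < 1 ->
  \sum_(i < n) i.+1%:R * z ^+ i.+1 <= z / (1 - z) ^+ 2.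
Proof.
move=> z0 z1; have d0 : 0 < 1 - z by lra.
have : (1 - z) ^+ 2 * (\sum_(i < n) i.+1%:R * z ^+ i.+1)
    = z - n.+1%:R * z ^+ n.+1 + n%:R * z ^+ n.+2.
  elim: n => [|n IH]; first by rewrite big_ord0 expr1 !mulr0n; ring.
  rewrite big_ord_recr /= mulrDr IH !exprS -!natr1; ring.
move=> e; rewrite ler_pdivlMr ?exprn_gt0 // mulrC e.
have : 0 <= z ^+ n.+1 * (n.+1%:R - n%:R * z).
  rewrite mulr_ge0 ?exprn_ge0 //.
  have : 0 <= (n%:R : R) by []. rewrite -natr1; nra.
by rewrite !exprS; lra.
Qed.

Lemma sum_inv_sqr_le (n : nat) : \sum_(1 <= j < n.+1) (j%:R : R) ^- 2 <= 7 / 4.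
Proof.
have [n1|n1] := leqP n 1.
  case: n n1 => [|[]] // _; first by rewrite big_geq //; lra.
  by rewrite big_nat1 expr1n invr1; lra.
suff : \sum_(1 <= j < n.+1) (j%:R : R) ^- 2 <= 7 / 4 - n%:R^-1.
  by have : 0 < (n%:R : R)^-1 by [rewrite invr_gt0 ltr0n; lia]; lra.
elim: n n1 => // n IH; rewrite ltnS leq_eqVlt => /orP[/eqP <-|n1].
  by rewrite big_nat_recr //= big_nat1 expr1n invr1; lra.
rewrite big_nat_recr //=; apply: le_trans (lerD (IH n1) (lexx _)) _.
have n0 : 0 < (n%:R : R) by rewrite ltr0n; lia.
have -> : n.+1%:R = n%:R + 1 :> R by rewrite natr1.
rewrite -subr_ge0.
have -> : 7 / 4 - (n%:R + 1)^-1 - (7 / 4 - n%:R^-1 + (n%:R + 1) ^- 2) =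
  (n%:R * (n%:R + 1) ^+ 2)^-1 :> R.
  by field; rewrite !gt_eqF //; lra.
by rewrite invr_ge0 mulr_ge0 ?sqr_ge0 // ltW.
Qed.

Lemma expR_8_3 : expR (8 / 3) <= 15 :> R.
Proof.
have h : expR (192^-1) <= 192 / 191 :> R.
  have := expR_ge1Dx (- 192^-1 : R); rewrite expRN => h.
  rewrite -(invrK (expR _)) -[192 / 191]invrK lef_pV2 ?posrE ?invr_gt0 ?expR_gt0 //; lra.
(* Nine squarings of e^(1/192) <= 192/191, rounded upwards to small fractions. *)
have step x r t : expR x <= r -> r * r <= t -> expR (x * 2) <= t.
  move=> xr; apply: le_trans; rewrite mulr_natr mulr2n expRD.
  by rewrite ler_pM ?expR_ge0.
have {}h := step _ _ (96 / 95) h ltac:(lra).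
have {}h := step _ _ (193 / 189) h ltac:(lra).
have {}h := step _ _ (195 / 187) h ltac:(lra).
have {}h := step _ _ (311 / 286) h ltac:(lra).
have {}h := step _ _ (162 / 137) h ltac:(lra).
have {}h := step _ _ (323 / 231) h ltac:(lra).
have {}h := step _ _ (436 / 223) h ltac:(lra).
have {}h := step _ _ (1013 / 265) h ltac:(lra).
have {}h := step _ _ 15 h ltac:(lra).
apply: le_trans h; rewrite ler_expR; lra.
Qed.

End Analytic.

Section PartitionBound.
Variable R : realType.
Local Open Scope ring_scope.

Lemma sqrt_sub_le (s x : R) : 0 < s -> 0 <= x <= s ^+ 2 ->
  Num.sqrt (s ^+ 2 - x) <= s - x / (2 * s).
Proof.
move=> s0 /andP[x0 xs].
have h : 0 <= s - x / (2 * s).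
  by rewrite subr_ge0 ler_pdivrMr ?mulr_gt0 //; nra.
rewrite -[leRHS]ger0_norm // -sqrtr_sqr ler_sqrt ?sqr_ge0 //.
have -> : (s - x / (2 * s)) ^+ 2 = s ^+ 2 - x + (x / (2 * s)) ^+ 2.
  by field; rewrite gt_eqF.
by rewrite lerDl sqr_ge0.
Qed.

Lemma card_partitions_le (n m : nat) : (m <= n)%N ->
  #|partitions_of n m|%:R <= expR (8 / 3 * Num.sqrt m%:R) :> R.
Proof.
elim/ltn_ind: m => m IH mn.
case: (posnP m) => [->|m0].
  rewrite sqrtr0 mulr0 expR0 lern1 -(cards1 ([ffun=> ord0] : {ffun 'I_n -> 'I_n.+1})).
  apply/subset_leq_card/subsetP=> l; rewrite !inE sum_nat_eq0 => /forallP l0.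
  apply/eqP/ffunP=> i; apply: val_inj; rewrite ffunE /=.
  by have := l0 i; rewrite muln_eq0 orbF => /eqP.
set s : R := Num.sqrt m%:R; set c : R := 8 / 3; set u : R := c / (2 * s).
have m0R : 0 < m%:R :> R by rewrite ltr0n.
have s0 : 0 < s by rewrite sqrtr_gt0.
have s2 : s ^+ 2 = m%:R by rewrite sqr_sqrtr // ltW.
have u0 : 0 < u by rewrite divr_gt0 ?mulr_gt0 // /c; lra.
rewrite -(ler_pM2l m0R) -natrM.
apply: le_trans (_ : (\sum_(1 <= j < n.+1) \sum_(i < n | (j * i.+1 <= m)%N)
    i.+1 * #|partitions_of n (m - j * i.+1)|)%N%:R <= _).
  by rewrite ler_nat partitions_recursion.
apply: le_trans (_ : \sum_(1 <= j < n.+1) expR (c * s) * (u ^- 2 * j%:R ^- 2) <= _).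
  rewrite natr_sum !big_nat; apply: ler_sum => j /andP[j0 _].
  have j0R : 0 < j%:R :> R by rewrite ltr0n.
  have uj0 : 0 < u * j%:R by rewrite mulr_gt0.
  have z1 : expR (- (u * j%:R)) < 1 by rewrite expR_lt1; lra.
  have := sum_nat_mul_exp_le n (expR_ge0 (- (u * j%:R))) z1.
  move/le_trans => /(_ _ (expRN_div_sqr_le uj0)).
  rewrite exprMn invfM => /(ler_wpM2l (expR_ge0 (c * s))); apply: le_trans.
  rewrite mulr_sumr natr_sum big_mkcond; apply: ler_sum => i _.
  case: ifPn => jim; last by rewrite !mulr_ge0 ?exprn_ge0 ?expR_ge0.
  rewrite natrM mulrCA ler_wpM2l //.
  apply: le_trans (IH _ _ _) _; [lia | lia |].
  rewrite -expRM_natl -expRD ler_expR natrB // natrM -/c.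
  set x : R := j%:R * i.+1%:R.
  have x0 : 0 <= x by rewrite mulr_ge0.
  have xs : x <= s ^+ 2 by rewrite s2 /x -natrM ler_nat.
  have /(ler_wpM2l (_ : 0 <= c)) : Num.sqrt (m%:R - x) <= s - x / (2 * s).
    by rewrite -s2 sqrt_sub_le // x0.
  have c0 : 0 <= c by rewrite /c; lra.
  move=> /(_ c0) h; apply: le_trans h _.
  rewrite le_eqVlt; apply/orP; left; apply/eqP; rewrite /u /x; field.
  by rewrite gt_eqF.
rewrite -big_distrr /= -big_distrr /= [X in _ <= X]mulrC ler_wpM2l ?expR_ge0 //.
apply: le_trans (_ : u ^- 2 * (7 / 4) <= _).
  by rewrite ler_wpM2l ?sum_inv_sqr_le // invr_ge0 exprn_ge0 // ltW.
have -> : u ^- 2 * (7 / 4) = 63 / 64 * s ^+ 2 by rewrite /u /c; field; rewrite gt_eqF.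
by rewrite s2; lra.
Qed.

Lemma two_powR_bound (n : nat) : (0 < n)%N ->
  1 + expR (8 / 3 * Num.sqrt n%:R) <= 2 `^ (4 * Num.sqrt n%:R) :> R.
Proof.
move=> n0; set s := Num.sqrt _.
have s1 : 1 <= s by rewrite -[leLHS]sqrtr1 ler_sqrt // ler1n.
have -> : 2 `^ (4 * s) = 16 `^ s :> R.
  rewrite powRrM; congr (_ `^ _); rewrite (powR_mulrn 4) //; lra.
rewrite -[16 `^ s]mulr_powRB1 //; last lra.
have h15 : expR (8 / 3 * s) <= 15 `^ s.
  rewrite expRM ge0_ler_powR ?nnegrE ?expR_ge0 //; [lra | exact: expR_8_3].
apply: le_trans (_ : 16 * 15 `^ (s - 1) <= _); last first.
  by rewrite ler_wpM2l // ge0_ler_powR ?nnegrE //; lra.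
have h1 : 1 <= 15 `^ (s - 1) :> R.
  have h0 : 0 <= s - 1 by lra.
  have h1 : (1 : R) <= 15 by lra.
  by have := ler_powR h1 h0; rewrite powRr0.
have : 15 `^ s = 15 * 15 `^ (s - 1) :> R by rewrite mulr_powRB1 //; lra.
lra.
Qed.
End PartitionBound.

(** * Cyclotomic kernels *)

Section Divisibility.

Variables (V : finType) (f : V -> V).

(* f generates a free action of the cyclic group of order e on S. *)
Lemma dvdn_card_free_cycle (S : {set V}) (e : nat) :
    0 < e -> (forall v, v \in S -> f v \in S) ->
    (forall v, v \in S -> iter e f v = v) ->
    (forall v t, v \in S -> iter t f v = v -> e %| t) ->
  e %| #|S|.
Proof.
move=> e0 fS fe free.
pose g v := if v \in S then f v else v.
have gS v : v \in S -> g v \in S by rewrite /g => vS; rewrite vS fS.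
have iter_g t v : v \in S -> iter t g v = iter t f v /\ iter t g v \in S.
  move=> vS; elim: t => [|t [IH1 IH2]] //=; split; last exact: gS.
  by rewrite -IH1 /g IH2.
have g_inj : injective g.
  apply: (can_inj (g := iter e.-1 g)) => v; rewrite -iterSr prednK //.
  case: (boolP (v \in S)) => vS; first by rewrite (iter_g e v vS).1 fe.
  by elim: e {e0 fe free} => //= t ->; rewrite /g (negPf vS).
rewrite -(@fcard_order_set _ g g_inj e (mem S)) ?dvdn_mull //; last first.
  by apply: intro_closed => [|x y /eqP <-]; [exact: fconnect_sym | exact: gS].
apply/subsetP=> v vS; rewrite inE /=; have ov := fingraph.order_gt0 g v.
rewrite eqn_dvd; apply/andP; split; last first.
  by apply: free (vS) _; rewrite -(iter_g _ _ vS).1 iter_order.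
have := iter_g e v vS; rewrite fe // => -[ge _].
rewrite /dvdn; apply/eqP; have := ltn_pmod e ov; set r := _ %% _ => lt_r.
have gr : iter r g v = v.
  rewrite -{2}ge (divn_eq e (fingraph.order g v)) -/r addnC iterD; congr (iter _ _ _).
  by elim: (e %/ _) => //= t IH; rewrite mulSn iterD -IH iter_order.
have : findex g v (iter r g v) = r by rewrite findex_iter.
by rewrite gr findex0.
Qed.

End Divisibility.

Section MultiplicativeOrder.

(* The order of q modulo e when these are coprime, and junk otherwise. *)
Definition mult_order (e q : nat) : nat :=
  (find (fun j => q ^ j.+1 == 1 %[mod e]) (iota 0 (totient e))).+1.

Lemma mult_orderP (e q : nat) : coprime e q -> 0 < e ->
  q ^ mult_order e q = 1 %[mod e] /\
  forall t, q ^ t = 1 %[mod e] -> mult_order e q %| t.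
Proof.
move=> co e0.
have hs : has (fun j => q ^ j.+1 == 1 %[mod e]) (iota 0 (totient e)).
  have t0 : 0 < totient e by rewrite totient_gt0.
  apply/hasP; exists (totient e).-1; first by rewrite mem_iota /=; lia.
  by rewrite prednK // cyclic.Euler_exp_totient // coprime_sym.
have lt := hs; rewrite has_find size_iota in lt.
have := nth_find 0 hs; rewrite nth_iota // add0n => /eqP qo.
split=> // t qt; have min j : j.+1 < mult_order e q -> q ^ j.+1 == 1 %[mod e] = false.
  rewrite /mult_order ltnS => jo; have := before_find 0 jo.
  by rewrite nth_iota ?add0n // (ltn_trans jo).
have := ltn_pmod t (ltn0Sn _ : 0 < mult_order e q); rewrite /dvdn.
case er: (t %% mult_order e q) => [|r] // /min.
suff -> : q ^ r.+1 == 1 %[mod e] by [].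
have {}qo : q ^ mult_order e q = 1 %[mod e] := qo.
have e1 : (q ^ mult_order e q) ^ (t %/ mult_order e q) = 1 %[mod e].
  by rewrite -modnXm qo modnXm exp1n.
apply/eqP; rewrite -qt [in RHS](divn_eq t (mult_order e q)) expnD (mulnC (t %/ _)) expnM.
by rewrite -[in RHS]modnMml e1 modnMml mul1n er.
Qed.

Lemma mult_order_gt0 (e q : nat) : 0 < mult_order e q.
Proof. by []. Qed.

End MultiplicativeOrder.

Section CyclotomicKernels.

Variables (F : finFieldType).
Local Open Scope ring_scope.
Implicit Types (e k t : nat).

Lemma coprime_card_natr e : coprime e #|F| = (e%:R != 0 :> F).
Proof.
have [p pp pF] := finPcharP F; rewrite -(dvdn_pcharf pF).
have [r qr] : exists r, #|F| = (p ^ r)%N.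
  by exists (logn p #|pPrimeCharType pF|); apply: card_pprimeChar.
have r0 : (0 < r)%N by have := card_finNzRing_gt1 F; rewrite qr; case: (r).
by rewrite qr coprime_pexpr // coprime_sym prime_coprime.
Qed.

Definition cyclotomic_over e : {poly F} := map_poly intr 'Phi_e.

Lemma prod_cyclotomic_over k : (0 < k)%N ->
  \prod_(d <- divisors k) cyclotomic_over d = 'X^k - 1.
Proof.
move=> k0; rewrite -(rmorph_prod (map_poly intr)) /= prod_Cyclotomic //.
by rewrite rmorphB rmorph1 /= map_polyXn.
Qed.

Lemma cyclotomic_over_coprime k d e :
    k%:R != 0 :> F -> (d %| k)%N -> (e %| k)%N -> d != e ->
  coprimep (cyclotomic_over d) (cyclotomic_over e).
Proof.
move=> kF dk ek de; have k0 : (0 < k)%N by case: k kF {dk ek} => //; rewrite eqxx.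
have := separable_Xn_sub_1 kF; rewrite -prod_cyclotomic_over //.
rewrite (big_rem d) /= -?dvdn_divisors // (big_rem e) /=; last first.
  by rewrite mem_rem_uniq ?divisors_uniq // !inE eq_sym de -dvdn_divisors.
by rewrite separable_mul => /and3P[_ _]; rewrite coprimepMr => /andP[].
Qed.

Lemma cyclotomic_over_coprime_Xn_sub_1 e t :
    e%:R != 0 :> F -> (t %| e)%N -> (t < e)%N ->
  coprimep (cyclotomic_over e) ('X^t - 1).
Proof.
move=> eF te lte; have e0 : (0 < e)%N by apply: leq_ltn_trans lte.
have t0 : (0 < t)%N by apply: dvdn_gt0 te.
rewrite -prod_cyclotomic_over // big_seq.
elim/big_ind: _ => [|p1 p2 c1 c2|d]; first exact: coprimep1.
  by rewrite coprimepMr c1.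
rewrite -dvdn_divisors // => dt; apply: (cyclotomic_over_coprime eF) => //.
  exact: dvdn_trans te.
by apply: contraTneq lte => ->; rewrite -leqNgt dvdn_leq.
Qed.

Variables (n' : nat) (A : 'M[F]_n'.+1).
Let n := n'.+1.

Lemma row_iter_fixed (v : 'rV[F]_n) t s :
  v *m A ^+ t = v -> v *m A ^+ (t * s) = v.
Proof.
move=> vt; elim: s => [|s IH]; first by rewrite muln0 expr0 mulmx1.
by rewrite mulnS exprD -mulmxE mulmxA vt.
Qed.

Lemma cyclotomic_ker_fixed e (v : 'rV[F]_n) : (0 < e)%N ->
  v *m horner_mx A (cyclotomic_over e) = 0 -> v *m A ^+ e = v.
Proof.
move=> e0 v0; have := prod_cyclotomic_over e0.
rewrite (big_rem e) /= -?dvdn_divisors // => /(congr1 (fun p => v *m horner_mx A p)).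
rewrite rmorphM -mulmxE mulmxA v0 mul0mx rmorphB rmorphXn rmorph1 /= horner_mx_X.
by rewrite mulmxBr mulmx1 => /eqP; rewrite eq_sym subr_eq0 => /eqP.
Qed.

Lemma cyclotomic_ker_period e t (v : 'rV[F]_n) : e%:R != 0 :> F -> v != 0 ->
  v *m horner_mx A (cyclotomic_over e) = 0 -> v *m A ^+ t = v -> (e %| t)%N.
Proof.
move=> eF v0 vk vt; have e0 : (0 < e)%N by case: e eF {vk} => //; rewrite eqxx.
have ve := cyclotomic_ker_fixed e0 vk.
have vg : v *m A ^+ gcdn e t = v.
  have [a _ /dvdnP[b ab]] := Bezoutl t e0.
  rewrite -[in LHS](row_iter_fixed a vt) -mulmxA mulmxE -exprD.
  by rewrite [(t * a)%N]mulnC addnC ab mulnC row_iter_fixed.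
have ge : (gcdn e t %| e)%N by exact: dvdn_gcdl.
have [lt|] := ltnP (gcdn e t) e; last first.
  move=> le; have -> : e = gcdn e t by apply/eqP; rewrite eqn_leq le dvdn_leq.
  exact: dvdn_gcdr.
have := mxdirect_kermxpoly A (cyclotomic_over_coprime_Xn_sub_1 eF ge lt).
move=> c0; case/eqP: v0; apply/eqP; rewrite -submx0 -c0 sub_capmx /kermxpoly.
apply/andP; split; apply/sub_kermxP => //.
by rewrite rmorphB rmorphXn rmorph1 /= horner_mx_X mulmxBr mulmx1 vg subrr.
Qed.

(* This is dim ker N^(j+1) - dim ker N^j, in a form visibly nonincreasing in j. *)
Definition ker_increment (N : 'M[F]_n) (j : nat) : nat := \rank (N ^+ j :&: kermx N)%MS.

Lemma mxrank_exp_increment (N : 'M[F]_n) j :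
  (\rank (N ^+ j.+1) + ker_increment N j = \rank (N ^+ j))%N.
Proof. by rewrite exprSr -mulmxE mxrank_mul_ker. Qed.

Lemma ker_increment_noninc (N : 'M[F]_n) j :
  (ker_increment N j.+1 <= ker_increment N j)%N.
Proof. by apply/mxrankS/capmxS; rewrite // exprS -mulmxE submxMl. Qed.

Lemma mxrank_exp (N : 'M[F]_n) j :
  (\rank (N ^+ j) + \sum_(i < j) ker_increment N i = n)%N.
Proof.
elim: j => [|j IH]; first by rewrite big_ord0 addn0 expr0 mxrank1.
by rewrite big_ord_recr /= -[RHS]IH -(mxrank_exp_increment N j) addnA addnAC.
Qed.

Lemma ker_increment_mono (N : 'M[F]_n) i j : (i <= j)%N ->
  (ker_increment N j <= ker_increment N i)%N.
Proof.
move=> /subnK <-; elim: (j - i)%N => // m IH.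
exact: leq_trans (ker_increment_noninc N _) IH.
Qed.

(* A acts on the subspace measured by the increment, and every nonzero orbit
   there has length e. *)
Lemma dvdn_cyclotomic_increment e j : (0 < e)%N -> coprime e #|F| ->
  (mult_order e #|F| %| ker_increment (horner_mx A (cyclotomic_over e)) j)%N.
Proof.
move=> e0 co; have [_ min] := mult_orderP co e0; apply: min.
have eF : e%:R != 0 :> F.
  by rewrite -coprime_card_natr.
set N := horner_mx A _; pose W := (N ^+ j :&: kermx N)%MS.
have comm : A *m N = N *m A by apply/esym/comm_horner_mx.
have commX : A *m N ^+ j = N ^+ j *m A.
  by rewrite mulmxE; apply: commrX; exact: comm.
have WA (v : 'rV[F]_n) : (v <= W)%MS -> (v *m A <= W)%MS.
  rewrite !sub_capmx => /andP[/submxP[u ->] /sub_kermxP vN]; apply/andP; split.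
    by rewrite -mulmxA -commX mulmxA submxMl.
  by apply/sub_kermxP; rewrite -mulmxA comm mulmxA vN mul0mx.
have WN (v : 'rV[F]_n) : (v <= W)%MS -> v *m N = 0.
  by rewrite sub_capmx => /andP[_ /sub_kermxP].
have iterA v t : iter t (mulmxr A) v = v *m A ^+ t :> 'rV[F]_n.
  elim: t v => [|t IH] v; first by rewrite expr0 mulmx1.
  by rewrite iterSr IH exprS -mulmxE mulmxA.
have := @dvdn_card_free_cycle _ (mulmxr A : 'rV[F]_n -> 'rV[F]_n) [set v | (v != 0) && (v <= W)%MS] e e0.
have -> : #|[set v : 'rV[F]_n | (v != 0) && (v <= W)%MS]| = (#|F| ^ \rank W - 1)%N.
  rewrite -card_rowg (cardsD1 0 (rowg W)) inE sub0mx add1n subn1 /=.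
  by apply: eq_card => v; rewrite !inE.
rewrite -/(ker_increment N j) => dv; apply/eqP; rewrite eqn_mod_dvd ?expn_gt0.
  apply: dv => [v|v|v t]; rewrite !inE => /andP[v0 vW].
  - rewrite /= WA // andbT; apply: contra v0 => /eqP vA0.
    have := cyclotomic_ker_fixed e0 (WN v vW).
    by rewrite -(prednK e0) exprS -mulmxE mulmxA vA0 mul0mx => <-.
  - by rewrite iterA; apply: cyclotomic_ker_fixed (WN v vW).
  - by rewrite iterA => vt; apply: (cyclotomic_ker_period eF v0 (WN v vW) vt).
by rewrite ltnW // card_finNzRing_gt1.
Qed.

Lemma powers_eventually_periodic :
  exists a0 k0, (0 < k0)%N /\ forall a m, (a0 <= a)%N -> A ^+ (a + k0 * m) = A ^+ a.
Proof.
have iterE i : iter i (mulmx A) 1 = A ^+ i.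
  by elim: i => [|i IH]; rewrite ?expr0 //= IH exprS.
pose o := fingraph.order (mulmx A) (1 : 'M[F]_n).
have /loopingP/(_ o) := looping_order (mulmx A) (1 : 'M[F]_n).
case/trajectP=> i; rewrite -/o !iterE => lt_i e.
exists i, (o - i)%N; split; first by rewrite subn_gt0.
move=> a m ia; elim: m => [|m IH]; first by rewrite muln0 addn0.
rewrite mulnS addnCA -[RHS]IH -(subnK ia).
have -> : (o - i + (a - i + i + (o - i) * m) = (a - i + (o - i) * m) + o)%N by lia.
have -> : (a - i + i + (o - i) * m = (a - i + (o - i) * m) + i)%N by lia.
by rewrite !exprD e.
Qed.

End CyclotomicKernels.

(** * Multiplicities from kernel dimensions *)

Section SecondDifferences.

Lemma sum_second_difference (a : nat -> nat) (K J : nat) :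
    (forall j, a j.+1 <= a j) ->
  \sum_(k < K) minn k.+1 J * (a k - a k.+1) + minn K J * a K = \sum_(j < minn K J) a j.
Proof.
move=> mono; elim: K => [|K IH]; first by rewrite min0n !big_ord0.
rewrite big_ord_recr /= -addnA -mulnDr subnK //.
have [KJ|JK] := leqP J K.
  by move: IH; rewrite !(minn_idPr _) // ltnW.
move: IH; rewrite (minn_idPl (ltnW JK)) (minn_idPl JK) big_ord_recr /= => <-.
by rewrite mulSn addnCA addnC.
Qed.

Lemma sum_ord_multiples (G : nat -> nat) (n o : nat) : 0 < o ->
  \sum_(i < n | o %| i.+1) G i.+1 = \sum_(k < n %/ o) G (o * k.+1).
Proof.
move=> o0; elim: n => [|n IH]; first by rewrite div0n !big_ord0.
rewrite big_mkcond big_ord_recr /= -big_mkcond IH divnS //.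
case: ifP => on; last by rewrite addn0 add0n.
rewrite add1n big_ord_recr /=; congr (_ + G _).
have : n.+1 %/ o = (n %/ o).+1 by rewrite divnS // on.
by move=> <-; rewrite mulnC divnK.
Qed.

Lemma sum_multiples_second_difference (d : nat -> nat) (n o J : nat) : 0 < o ->
    (forall j, d j.+1 <= d j) -> (forall j, o %| d j) ->
    (forall j, d j != 0 -> j.+1 * o <= n) ->
  \sum_(i < n | o %| i.+1)
     minn i.+1 (o * J) * ((d (i.+1 %/ o).-1 - d (i.+1 %/ o)) %/ o)
    = \sum_(j < J) d j.
Proof.
move=> o0 mono od bound; pose a j := d j %/ o.
have da j : d j = o * a j by rewrite mulnC divnK.
have a0 j : n %/ o <= j -> a j = 0.
  move=> nj; apply/eqP; apply: contraTT nj => aj; rewrite -ltnNge.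
  by rewrite leq_divRL // bound // da muln_eq0 negb_or -lt0n o0.
have amono j : a j.+1 <= a j by rewrite leq_div2r.
rewrite (@sum_ord_multiples (fun t => minn t (o * J) * ((d (t %/ o).-1 - d (t %/ o)) %/ o))) //.
transitivity (o * \sum_(k < n %/ o) minn k.+1 J * (a k - a k.+1)).
  rewrite big_distrr /=; apply: eq_bigr => k _.
  by rewrite mulKn //= -minnMr !da -mulnBr mulKn // mulnA.
under [RHS]eq_bigr do rewrite da.
rewrite -big_distrr /=; congr (o * _).
have := sum_second_difference (n %/ o) J amono; rewrite a0 // muln0 addn0 => ->.
have [KJ|JK] := leqP (n %/ o) J => //.
rewrite -(subnKC KJ) big_split_ord /= [X in _ = _ + X]big1 ?addn0 // => i _.
by rewrite a0 // leq_addr.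
Qed.

Lemma sum_divisors (g : nat -> nat) (k M : nat) : 0 < k ->
    (forall d, M <= d -> g d = 0) ->
  \sum_(d <- divisors k) g d = \sum_(d < M | (0 < d) && (d %| k)) g d.
Proof.
move=> k0 g0; pose K := maxn M k.+1.
transitivity (\sum_(0 <= d < K | (0 < d) && (d %| k)) g d).
  rewrite -[RHS]big_filter; apply: perm_big; apply: uniq_perm.
  - exact: divisors_uniq.
  - exact/filter_uniq/iota_uniq.
  move=> d; rewrite -dvdn_divisors // mem_filter mem_index_iota /=.
  apply/idP/idP => [dk|/andP[/andP[_ //]]].
  by rewrite dk (dvdn_gt0 k0 dk) /= leq_max ltnS (dvdn_leq k0 dk) orbT.
rewrite (big_cat_nat (n := M)) ?leq_maxl //= big_mkord.
rewrite [X in _ + X]big_nat_cond [X in _ + X]big1 ?addn0 // => d.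
by case/andP=> /andP[/g0].
Qed.

End SecondDifferences.

Section Invariants.

Variables (F : finFieldType) (p : nat) (pF : p \in [pchar F]%R) (n' : nat).
Let n := n'.+1.
Let q := #|F|.
Local Open Scope ring_scope.

Definition divisor_support (i : 'I_n) : {set 'I_(q ^ n)} :=
  [set e : 'I_(q ^ n) | (0 < e)%N && (e %| q ^ i.+1 - 1)%N].

(* dim ker (A^k - 1), where D i e counts the blocks of size i + 1 and order e:
   with d = ord_e q and i + 1 = d m, such a block is F[X]/(f^m) for an
   irreducible f of degree d dividing Phi_e. *)
Definition fixed_dim (D : {ffun 'I_n -> {ffun 'I_(q ^ n) -> 'I_n.+1}}) (k : nat) : nat :=
  \sum_(e < q ^ n | (0 < e)%N && (e %| k`_p^')%N)
     \sum_(i < n) (minn i.+1 (mult_order e q * k`_p) * D i e)%N.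

Variable A : 'M[F]_n.

Let inc e j := ker_increment (horner_mx A (cyclotomic_over F e)) j.

Lemma kermx_exp_rank (N : 'M[F]_n) j :
  \rank (kermx (N ^+ j)) = (\sum_(i < j) ker_increment N i)%N.
Proof.
apply/eqP; rewrite mxrank_ker -(eqn_add2l (\rank (N ^+ j))) subnKC ?rank_leq_row //.
by apply/eqP/esym/mxrank_exp.
Qed.

Lemma kermx_expB1_rank k : (0 < k)%N ->
  \rank (kermx (A ^+ k - 1)) = (\sum_(e <- divisors k`_p^') \sum_(j < k`_p) inc e j)%N.
Proof.
move=> k0; have k'0 : (0 < k`_p^')%N by apply: part_gt0.
have k'F : (k`_p^')%:R != 0 :> F.
  rewrite -(dvdn_pcharf pF).
  have pp := pcharf_prime pF.
  by have := part_pnat p^' k; rewrite p'natE.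
have pk_nat : [pchar {poly F}].-nat (k`_p)%N.
  rewrite (eq_pnat _ (pchar_lalg {poly F})) (eq_pnat _ (pcharf_eq pF)).
  exact: part_pnat.
pose s := in_tuple (divisors k`_p^').
have XkE : 'X^k - 1 = \prod_(i < size (divisors k`_p^')) cyclotomic_over F (tnth s i) ^+ (k`_p)%N.
  rewrite -(big_tnth _ _ (divisors k`_p^') xpredT (fun d => cyclotomic_over F d ^+ (k`_p)%N)).
  rewrite prodrXl prod_cyclotomic_over // exprDn_pchar.
    by rewrite exprNn_pchar; [|exact: pk_nat]; rewrite -exprM expr1n mulnC partnC.
  exact: pk_nat.
have sD i : (tnth s i %| k`_p^')%N by rewrite dvdn_divisors // mem_tnth.
have cop : {in xpredT &, forall i j : 'I_(size (divisors k`_p^')), j != i ->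
    coprimep (cyclotomic_over F (tnth s i) ^+ (k`_p)%N) (cyclotomic_over F (tnth s j) ^+ (k`_p)%N)}.
  move=> i j _ _ ji; apply/coprimep_expl/coprimep_expr.
  apply: (cyclotomic_over_coprime k'F) => //.
  by rewrite (inj_eq (tuple_uniqP s (divisors_uniq _))) eq_sym.
have -> : kermx (A ^+ k - 1) = kermxpoly A ('X^k - 1).
  transitivity (kermx (horner_mx A ('X^k - 1))) => //.
  by rewrite rmorphB rmorphXn rmorph1 /= horner_mx_X.
rewrite XkE (kermxpoly_prod A cop) (mxdirectP (mxdirect_sum_kermx A cop)) /=.
rewrite [RHS](big_tnth _ _ (divisors k`_p^')); apply: eq_bigr => i _.
transitivity (\rank (kermx (horner_mx A (cyclotomic_over F (tnth s i) ^+ (k`_p)%N)))).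
  by [].
by rewrite rmorphXn /= kermx_exp_rank.
Qed.

Definition nilpotent_multiplicities : {ffun 'I_n -> 'I_n.+1} :=
  [ffun i : 'I_n => inord (ker_increment A i - ker_increment A i.+1)].

Definition cyclic_multiplicities : {ffun 'I_n -> {ffun 'I_(q ^ n) -> 'I_n.+1}} :=
  [ffun i : 'I_n => [ffun e : 'I_(q ^ n) =>
    if e \in divisor_support i then
      inord ((inc e (i.+1 %/ mult_order e q).-1 - inc e (i.+1 %/ mult_order e q))
               %/ mult_order e q)
    else ord0]].

Lemma ker_increment_le (N : 'M[F]_n) j : (ker_increment N j <= n)%N.
Proof. exact: rank_leq_row. Qed.

Lemma ker_increment_bound (N : 'M[F]_n) o : (forall j, o %| ker_increment N j)%N ->
  forall j, (ker_increment N j != 0 -> j.+1 * o <= n)%N.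
Proof.
move=> od j dj; rewrite -[X in (_ <= X)%N](mxrank_exp N j.+1); apply: leq_trans (leq_addl _ _).
rewrite -[X in (X * _)%N]card_ord -sum_nat_const; apply: leq_sum => i _.
apply: leq_trans (ker_increment_mono N (_ : i <= j)%N); last by rewrite -ltnS.
by rewrite dvdn_leq // lt0n.
Qed.

Lemma nilpotent_multiplicities_sum J :
  (\sum_(i < n) minn i.+1 J * nilpotent_multiplicities i
    = \sum_(j < J) ker_increment A j)%N.
Proof.
rewrite -(@sum_multiples_second_difference _ n 1 J) //; last 2 first.
- exact: ker_increment_noninc.
- exact/ker_increment_bound.
rewrite [RHS]big_mkcond; apply: eq_bigr => i _ /=.
rewrite dvd1n mul1n !divn1 /= ffunE inordK //.
by rewrite ltnS (leq_trans (leq_subr _ _)) // ker_increment_le.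
Qed.

Lemma mxrank_exp_multiplicities J :
  \rank (A ^+ J) = (n - \sum_(i < n) minn i.+1 J * nilpotent_multiplicities i)%N.
Proof. by rewrite nilpotent_multiplicities_sum -[X in (X - _)%N](mxrank_exp A J) addnK. Qed.

Lemma dvdn_mult_order (e t : nat) : (0 < e)%N -> (0 < t)%N ->
  (e %| q ^ t - 1)%N = coprime e q && (mult_order e q %| t)%N.
Proof.
move=> e0 t0; have q0 : (0 < q)%N by rewrite ltnW // card_finNzRing_gt1.
rewrite -eqn_mod_dvd ?expn_gt0 ?q0 //; apply/idP/andP => [/eqP qt|[co]].
  have co : coprime e q.
    rewrite -(coprime_pexpr _ _ t0) -coprime_modr qt coprime_modr.
    exact: coprimen1.
  by split=> //; apply: (mult_orderP co e0).2.
case/dvdnP=> m ->; have [qo _] := mult_orderP co e0.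
by rewrite mulnC expnM -modnXm qo modnXm exp1n.
Qed.

Lemma cyclic_multiplicities_sum (e : 'I_(q ^ n)) J : (0 < e)%N -> coprime e q ->
  (\sum_(i < n) minn i.+1 (mult_order e q * J) * cyclic_multiplicities i e
    = \sum_(j < J) inc e j)%N.
Proof.
move=> e0 co; have od j := dvdn_cyclotomic_increment A j e0 co.
rewrite -(@sum_multiples_second_difference _ n (mult_order e q) J) //; last 2 first.
- by move=> j; apply: ker_increment_noninc.
- exact/ker_increment_bound.
rewrite [RHS]big_mkcond; apply: eq_bigr => i _ /=.
rewrite !ffunE inE e0 dvdn_mult_order // co /=; case: ifP => _; last by rewrite muln0.
rewrite inordK // ltnS (leq_trans (leq_div _ _)) // (leq_trans (leq_subr _ _)) //.
exact: ker_increment_le.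
Qed.

Lemma supported_cyclic_multiplicities : supported divisor_support cyclic_multiplicities.
Proof.
apply/forallP=> i; apply/forallP=> e; apply/implyP=> ei.
by rewrite !ffunE (negPf ei).
Qed.

Lemma inc_large e j : (0 < e)%N -> coprime e q -> (q ^ n <= e)%N -> inc e j = 0%N.
Proof.
move=> e0 co; apply: contraTeq => de; rewrite -ltnNge.
have od := dvdn_cyclotomic_increment A _ e0 co.
have := ker_increment_bound od de; rewrite mulSn => on.
have {}on : (mult_order e q <= n)%N by apply: leq_trans on; exact: leq_addr.
have := dvdn_mult_order e0 (mult_order_gt0 e q); rewrite co dvdnn /= => /dvdn_leq le.
have q1 : (1 < q)%N by apply: card_finNzRing_gt1.
apply: leq_ltn_trans (le _) _; first by rewrite subn_gt0 -(exp1n (mult_order e q)) ltn_exp2r.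
rewrite subn1 prednK ?expn_gt0 ?(ltnW q1) //.
by rewrite leq_exp2l.
Qed.

Lemma coprime_part e k : (0 < k)%N -> (e %| k`_p^')%N -> coprime e q.
Proof.
move=> k0 ek; rewrite coprime_card_natr -(dvdn_pcharf pF).
have := part_pnat p^' k; rewrite p'natE ?(pcharf_prime pF) //; apply: contra.
by move/dvdn_trans; apply.
Qed.

Lemma fixed_dimE k : (0 < k)%N ->
  \rank (kermx (A ^+ k - 1)) = fixed_dim cyclic_multiplicities k.
Proof.
move=> k0; rewrite kermx_expB1_rank //.
have k'0 : (0 < k`_p^')%N by apply: part_gt0.
pose g e := if (e %| k`_p^')%N then (\sum_(j < k`_p) inc e j)%N else 0%N.
rewrite (eq_big_seq g); last by move=> e; rewrite /g -dvdn_divisors // => ->.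
rewrite (sum_divisors (M := (q ^ n)%N)) //; last first.
  move=> e qe; rewrite /g; case: ifP => // ek; rewrite big1 // => j _.
  by rewrite inc_large ?(dvdn_gt0 k'0 ek) // (coprime_part k0).
apply: eq_bigr => e /andP[e0 ek]; rewrite /g ek cyclic_multiplicities_sum //.
exact: coprime_part ek.
Qed.

Lemma weight_multiplicities :
  (\sum_(i < n) nilpotent_multiplicities i * i.+1 + weight cyclic_multiplicities = n)%N.
Proof.
have [a0 [k0 [k00 per]]] := powers_eventually_periodic A.
have pp := pcharf_prime pF.
have [k [k_gt0 perk pk fk]] : exists k, [/\ (0 < k)%N,
    forall a, (a0 <= a)%N -> A ^+ (a + k) = A ^+ a,
    (p ^ n %| k)%N & forall e, (0 < e <= q ^ n)%N -> (e %| k)%N].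
  exists (k0 * (p ^ n * (q ^ n)`!))%N; split.
  - by rewrite !muln_gt0 k00 expn_gt0 prime_gt0 // fact_gt0.
  - by move=> a; apply: per.
  - exact/dvdn_mull/dvdn_mulr.
  - by move=> e he; do 2!apply: dvdn_mull; apply: dvdn_fact.
pose a := maxn a0 n.
have ann : horner_mx A ('X^a * ('X^k - 1)) = 0.
  rewrite rmorphM rmorphB !rmorphXn rmorph1 /= horner_mx_X mulrBr mulr1 -exprD.
  by rewrite perk ?subrr // leq_maxl.
have cop : coprimep ('X^a : {poly F}) ('X^k - 1).
  apply: coprimep_expl; rewrite coprimep_sym coprimepX /root !hornerE.
  by rewrite expr0n eqn0Ngt k_gt0 /= sub0r oppr_eq0 oner_eq0.
have := mxrank_sum_cap (kermxpoly A 'X^a) (kermxpoly A ('X^k - 1)).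
rewrite (mxdirect_kermxpoly _ cop) mxrank0 addn0 -(kermxpolyM _ cop).
have -> : \rank (kermxpoly A ('X^a * ('X^k - 1))) = n.
  transitivity (\rank (kermx (horner_mx A ('X^a * ('X^k - 1))))) => //.
  by rewrite ann kermx0 mxrank1.
have -> : kermxpoly A 'X^a = kermx (A ^+ a).
  transitivity (kermx (horner_mx A 'X^a)) => //.
  by rewrite rmorphXn /= horner_mx_X.
have -> : kermxpoly A ('X^k - 1) = kermx (A ^+ k - 1).
  transitivity (kermx (horner_mx A ('X^k - 1))) => //.
  by rewrite rmorphB rmorphXn rmorph1 /= horner_mx_X.
rewrite kermx_exp_rank -nilpotent_multiplicities_sum fixed_dimE // => dimE; rewrite [RHS]dimE; congr (_ + _)%N.
  apply: eq_bigr => i _; rewrite mulnC (minn_idPl _) //.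
  by rewrite (leq_trans _ (leq_maxr _ _)).
rewrite /weight exchange_big /= /fixed_dim [RHS]big_mkcond /=; apply: eq_bigr => e _.
have D0 (i : 'I_n) : ~~ ((0 < e)%N && (e %| k`_p^')%N) -> cyclic_multiplicities i e = ord0.
  move=> en; apply/eqP; apply: contraNT en => De.
  have := supported_cyclic_multiplicities => /forallP/(_ i)/forallP/(_ e).
  rewrite (negPf De) implybF negbK inE => /andP[e0 eq1]; rewrite e0 /=.
  have ek : (e %| k)%N by apply: fk; rewrite e0 ltnW.
  move: eq1; rewrite dvdn_mult_order // => /andP[co _].
  rewrite -(Gauss_dvdr _ (_ : coprime e k`_p)) ?partnC //.
  rewrite p_part; case: (posnP (logn p k)) => [->|l0]; first by rewrite expn0 coprimen1.
  rewrite coprime_pexpr // coprime_sym prime_coprime // (dvdn_pcharf pF).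
  by rewrite -coprime_card_natr.
case: ifPn => [_|en]; last by apply: big1 => i _; rewrite D0.
apply: eq_bigr => i _; rewrite mulnC (minn_idPl _) //.
have le_pk : (p ^ n <= k`_p)%N.
  by rewrite dvdn_leq ?part_gt0 // p_part pfactor_dvdn // pfactorK // -pfactor_dvdn.
apply: leq_trans (leq_pmull _ (mult_order_gt0 e q)).
by apply: leq_trans le_pk; apply: leq_trans (ltn_ord i) (ltnW (ltn_expl _ (prime_gt1 pp))).
Qed.

End Invariants.

(** * The upper bound *)

Section EquivalencePartition.

Variables (T : finType) (R : rel T) (X : {set T}).
Hypothesis eqR : equivalence_rel R.

Lemma leq_card_equivalence_partition (U : finType) (Y : {set U}) (h : U -> T) :
    (forall y, y \in Y -> h y \in X) ->
    (forall y y', y \in Y -> y' \in Y -> R (h y) (h y') -> y = y') ->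
  #|Y| <= #|equivalence_partition R X|.
Proof.
move=> hX inj; pose c x := [set y in X | R x y].
rewrite -(@card_in_imset _ _ (c \o h) Y).
  apply/subset_leq_card/subsetP=> _ /imsetP[y yY ->].
  by apply/imsetP; exists (h y); rewrite ?hX.
move=> y y' yY y'Y /setP/(_ (h y')); rewrite !inE hX //=.
have [-> _] := eqR (h y') (h y') (h y'); move=> Ryy'.
by apply: inj.
Qed.

Lemma card_equivalence_partition_leq (U : finType) (Y : {set U}) (P : T -> U -> Prop) :
    (forall x, x \in X -> exists2 y, y \in Y & P x y) ->
    (forall x x' y, P x y -> P x' y -> R x x') ->
  #|equivalence_partition R X| <= #|Y|.
Proof.
move=> ex inj; pose c x := [set y in X | R x y].
pose r B : option U := [pick y in Y | `[< exists2 x, B = c x & P x y >]].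
have rP B : B \in equivalence_partition R X ->
    exists2 y, r B = Some y & y \in Y /\ exists2 x, B = c x & P x y.
  case/imsetP=> x /ex[y yY Pxy] ->; rewrite /r; case: pickP => [z /andP[zY /asboolP Pz]|no].
    by exists z.
  by have := no y; rewrite yY /= => /asboolPn[]; exists x.
rewrite -(card_in_imset (f := r)); last first.
  move=> B B' /rP[y rB [_ [x Bx Px]]] /rP[y' rB' [_ [x' Bx' Px']]].
  rewrite rB rB' Bx Bx' => -[yy']; rewrite -yy' in Px'.
  have Rxx' := inj _ _ _ Px Px'.
  apply/setP=> z; rewrite !inE; congr (_ && _).
  by have [_ ->] := eqR x x' z.
rewrite -(card_imset Y (@Some_inj _ : injective (@Some U))); apply/subset_leq_card/subsetP.
by move=> _ /imsetP[B /rP[y -> [yY _]] ->]; apply: imset_f.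
Qed.

End EquivalencePartition.

Section MatrixGraphs.

Variables (F : finFieldType).
Local Open Scope ring_scope.

Definition matrix_graph n (A : 'M[F]_n) : {set 'rV[F]_n * 'rV[F]_n} :=
  functional_graph (mulmxr A).

Lemma mem_functional_graph (V : finType) (f : V -> V) (x y : V) :
  ((x, y) \in functional_graph f) = (y == f x).
Proof.
by apply/imsetP/eqP => [[v _ [-> ->]] //|->]; exists x.
Qed.

Lemma functional_graph_iso (V : finType) (f g : V -> V) :
  digraph_iso (functional_graph f) (functional_graph g)
    <-> exists s : {perm V}, forall v, s (f v) = g (s v).
Proof.
split=> [/existsP[s /forallP sP]|[s sP]].
  exists s => v; have /forallP/(_ (f v))/eqP := sP v.
  by rewrite !mem_functional_graph eqxx => /esym/eqP.
apply/existsP; exists s; apply/forallP=> x; apply/forallP=> y.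
by rewrite !mem_functional_graph -sP (inj_eq perm_inj).
Qed.

Lemma linear_graphsP n G :
  reflect (exists A : 'M[F]_n, G = matrix_graph A) (G \in linear_graphs F n).
Proof.
apply: (iffP imsetP) => [[T] | [A ->]].
  rewrite inE => /asboolP linT ->.
  pose TL : {linear 'rV[F]_n -> 'rV[F]_n} :=
    HB.pack (T : _ -> _) (GRing.isLinear.Build F 'rV[F]_n 'rV[F]_n _ (T : _ -> _) linT).
  exists (lin1_mx TL); apply/setP=> -[x y].
  rewrite /matrix_graph !mem_functional_graph; congr (_ == _).
  exact/esym/(mul_rV_lin1 TL).
exists [ffun v => v *m A].
  by rewrite inE; apply/asboolP=> a u v; rewrite !ffunE mulmxDl -scalemxAl.
by apply/setP=> -[x y]; rewrite /matrix_graph !mem_functional_graph ffunE.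
Qed.

Lemma iter_mulmxr n (A : 'M[F]_n) t (v : 'rV[F]_n) : iter t (mulmxr A) v = v *m A ^+ t.
Proof.
by elim: t v => [|t IH] v; rewrite ?expr0 ?mulmx1 // iterSr IH exprS -mulmxE mulmxA.
Qed.

Lemma card_fixed n (A : 'M[F]_n) t :
  #|[set v : 'rV[F]_n | iter t (mulmxr A) v == v]| = (#|F| ^ \rank (kermx (A ^+ t - 1)))%N.
Proof.
rewrite -card_rowg; apply: eq_card => v; rewrite !inE iter_mulmxr.
by rewrite (sameP sub_kermxP eqP) mulmxBr mulmx1 subr_eq0.
Qed.

Lemma in_iter_image_mulmxr n (A : 'M[F]_n) j (v : 'rV[F]_n) :
  in_iter_image (mulmxr A) j v = (v <= A ^+ j)%MS.
Proof.
apply/existsP/submxP => [[u /eqP <-]|[u ->]]; exists u; first exact: iter_mulmxr.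
by rewrite iter_mulmxr.
Qed.

Lemma card_preimages n' (A : 'M[F]_n'.+1) j (w : 'rV[F]_n'.+1) : (w <= A ^+ j.+1)%MS ->
  #|[set u | (mulmxr A u == w) && in_iter_image (mulmxr A) j u]|
    = (#|F| ^ (\rank (A ^+ j) - \rank (A ^+ j.+1)))%N.
Proof.
case/submxP=> z wz; rewrite -(mxrank_exp_increment A j) addKn -card_rowg.
rewrite -(card_imset (rowg _) (addrI (z *m A ^+ j))); apply: eq_card => u; rewrite !inE.
rewrite in_iter_image_mulmxr; apply/andP/imsetP => [[/eqP uw uj]|[v]].
  exists (u - z *m A ^+ j); last by rewrite addrC subrK.
  rewrite inE sub_capmx addmx_sub ?eqmx_opp ?submxMl //=.
  apply/sub_kermxP; rewrite mulmxBl -mulmxA mulmxE -exprSr -wz.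
  by apply/eqP; rewrite subr_eq0 -uw.
rewrite inE sub_capmx => /andP[vj /sub_kermxP v0] ->; split.
  by rewrite /= mulmxDl v0 addr0 -mulmxA mulmxE -exprSr wz.
by rewrite addmx_sub ?submxMl.
Qed.

Lemma matrix_graph_iso n' (A B : 'M[F]_n'.+1) :
    (forall j, \rank (A ^+ j) = \rank (B ^+ j)) ->
    (forall k, (0 < k)%N -> \rank (kermx (A ^+ k - 1)) = \rank (kermx (B ^+ k - 1))) ->
  digraph_iso (matrix_graph A) (matrix_graph B).
Proof.
move=> eq_rank eq_ker; apply/functional_graph_iso.
have [a [k [k0 per]]] := powers_eventually_periodic A.
apply: (@functions_conjugate _ _ _ _ a) => [t t0|v|j w w'].
- by rewrite !card_fixed eq_ker.
- rewrite in_iter_image_mulmxr => /submxP[u ->]; exists k => //.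
  by rewrite iter_mulmxr -mulmxA mulmxE -exprD -[k]muln1 per.
rewrite !in_iter_image_mulmxr => wA wB.
by rewrite !card_preimages // !eq_rank.
Qed.

End MatrixGraphs.

Section UpperBound.

Variables (F : finFieldType) (n' : nat).
Let n := n'.+1.
Let q := #|F|.

Let data : finType :=
  ({ffun 'I_n -> 'I_n.+1} * {ffun 'I_n -> {ffun 'I_(q ^ n) -> 'I_n.+1}})%type.

Definition class_data : {set data} :=
  [set y : data | supported (@divisor_support F n') y.2 &&
     (\sum_(i < n) y.1 i * i.+1 + weight y.2 == n)].

Lemma num_linear_graphs_le : num_linear_graphs F n <= #|class_data|.
Proof.
have [p _ pF] := finPcharP F.
rewrite /num_linear_graphs; apply: (@card_equivalence_partition_leq _ (@digraph_iso 'rV[F]_n) (linear_graphs F n)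
  (@digraph_iso_equiv _) data class_data
  (fun G y => exists2 A : 'M[F]_n, G = matrix_graph A
                & y = (nilpotent_multiplicities A, cyclic_multiplicities A))).
  move=> G /linear_graphsP[A ->]; exists (nilpotent_multiplicities A, cyclic_multiplicities A).
    by rewrite inE supported_cyclic_multiplicities /= (weight_multiplicities pF).
  by exists A.
move=> _ _ y [A -> ->] [B -> [mu_eq D_eq]]; apply: matrix_graph_iso => [j|k k0].
  by rewrite !mxrank_exp_multiplicities mu_eq.
by rewrite !(fixed_dimE pF) // D_eq.
Qed.

Lemma card_divisor_support (i : 'I_n) : #|divisor_support F i| = sigma q i.+1.
Proof.
have q1 : 1 < q by apply: card_finNzRing_gt1.
have qi0 : 0 < q ^ i.+1 - 1 by rewrite subn_gt0 -(exp1n i.+1) ltn_exp2r.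
rewrite cardE -(size_map val) /sigma; apply/perm_size/uniq_perm.
- by rewrite map_inj_uniq ?enum_uniq //; apply: val_inj.
- exact: divisors_uniq.
move=> d; rewrite -dvdn_divisors //; apply/mapP/idP => [[e]|di].
  by rewrite mem_enum inE => /andP[_ ei] ->.
have dn : d < q ^ n.
  apply: leq_ltn_trans (dvdn_leq qi0 di) _; rewrite subn1 prednK ?expn_gt0 ?(ltnW q1) //.
  by rewrite leq_exp2l.
by exists (Ordinal dn); rewrite // mem_enum inE (dvdn_gt0 qi0 di).
Qed.

Lemma sum_sigma :
  \sum_(l in weight_vectors n) \prod_(i < n) 'C(sigma q i.+1 + l i - 1, l i)
    = #|nonzero_supported (@divisor_support F n')|.
Proof.
rewrite -sum_weight_vectors; apply: eq_bigr => l _; apply: eq_bigr => i _.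
by rewrite card_divisor_support.
Qed.

(* Absorbs the data with no cyclic block, as the zero vector is not in P_n. *)
Lemma card_partitions_le_sum_sigma :
  #|partitions_of n n| <=
    \sum_(l in weight_vectors n) \prod_(i < n) 'C(sigma q i.+1 + l i - 1, l i).
Proof.
have q1 : 1 < q by apply: card_finNzRing_gt1.
apply: (@leq_trans #|weight_vectors n|).
  apply/subset_leq_card/subsetP=> l; rewrite !inE => /eqP ln.
  rewrite ln leqnn andbT -negb_forall; apply/negP=> /forallP l0.
  by have := ln; rewrite big1 // => i _; rewrite (eqP (l0 i)).
rewrite -sum1_card; apply: leq_sum => l _.
rewrite prodn_gt0 // => i; rewrite bin_gt0.
suff : 0 < sigma q i.+1 by lia.
rewrite /sigma; have : 1 \in divisors (q ^ i.+1 - 1).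
  by rewrite -dvdn_divisors ?dvd1n // subn_gt0 -(exp1n i.+1) ltn_exp2r.
by case: (divisors _).
Qed.

Local Open Scope ring_scope.

Lemma num_linear_graphs_upper (R : realType) :
  (num_linear_graphs F n)%:R <= 2 `^ (4 * Num.sqrt n%:R) *
    (\sum_(l in weight_vectors n) \prod_(i < n) 'C(sigma q i.+1 + l i - 1, l i))%N%:R :> R.
Proof.
set S := (\sum_(l in _) _)%N.
apply: le_trans (_ : #|class_data|%:R <= _); first by rewrite ler_nat num_linear_graphs_le.
pose B : R := expR (8 / 3 * Num.sqrt n%:R).
pose sup := supported (@divisor_support F n').
have -> : #|class_data| = (\sum_(D | sup D && (weight D <= n)) #|partitions_of n (n - weight D)|)%N.
  rewrite -sum1_card (partition_big snd (fun D => sup D && (weight D <= n)%N)) /=; last first.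
    by move=> [mu D]; rewrite inE /= => /andP[sD /eqP e]; rewrite /sup sD -[X in (_ <= X)%N]e leq_addl.
  apply: eq_bigr => D /andP[sD wD]; rewrite sum1dep_card.
  rewrite -(card_imset (partitions_of n _) (_ : injective (fun mu => (mu, D)))); last first.
    by move=> mu mu' [].
  apply: eq_card => -[mu D']; rewrite !inE /=; apply/andP/imsetP => [[/andP[sD' w] /eqP e]|].
    exists mu; last by rewrite e.
    by rewrite inE -[X in (X - _)%N](eqP w) e addnK.
  case=> mu' ; rewrite inE => /eqP w [-> ->]; split=> //.
  by rewrite w subnK // eqxx andbT.
have partB D : (weight D <= n)%N -> #|partitions_of n (n - weight D)|%:R <= B.
  move=> wD; apply: le_trans (card_partitions_le R (leq_subr _ _)) _.
  by rewrite ler_expR ler_wpM2l ?ler_sqrt ?ler_nat ?leq_subr //; lra.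
rewrite (bigID (fun D => weight D == 0)%N) /= natrD.
have zero : (\sum_(D | (sup D && (weight D <= n)) && (weight D == 0)) #|partitions_of n (n - weight D)| <= S)%N.
  apply: leq_trans card_partitions_le_sum_sigma.
  rewrite (eq_bigl (pred1 [ffun=> [ffun=> ord0]])) /= ?big_pred1_eq; last first.
    move=> D /=; apply/idP/eqP => [/andP[_ w0]|->]; last first.
      suff w0 : weight ([ffun=> [ffun=> ord0]] : {ffun 'I_n -> {ffun 'I_(q ^ n) -> 'I_n.+1}}) = 0%N.
        rewrite w0 eqxx leq0n !andbT; apply/forallP=> i; apply/forallP=> j; rewrite !ffunE.
        by rewrite eqxx implybT.
      by rewrite /weight big1 // => i _; rewrite big1 // => j _; rewrite !ffunE.
    apply/ffunP=> i; apply/ffunP=> j; apply: val_inj; rewrite !ffunE /=.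
    move: w0; rewrite /weight sum_nat_eq0 => /forallP/(_ i); rewrite sum_nat_eq0.
    by move/forallP/(_ j); rewrite muln_eq0 orbF => /eqP.
  suff -> : weight ([ffun=> [ffun=> ord0]] : {ffun 'I_n -> {ffun 'I_(q ^ n) -> 'I_n.+1}}) = 0%N.
    by rewrite subn0.
  by rewrite /weight big1 // => i _; rewrite big1 // => j _; rewrite !ffunE.
have nonzero : (\sum_(D | (sup D && (weight D <= n)) && (weight D != 0)) #|partitions_of n (n - weight D)|)%N%:R <= B * S%:R.
  rewrite natr_sum; apply: le_trans (ler_sum _ (_ : forall D, _ -> _ <= B)) _.
    by move=> D /andP[/andP[_ wD] _]; apply: partB.
  rewrite sumr_const -[B *+ _]mulr_natr /S sum_sigma.
  rewrite le_eqVlt; apply/orP; left; apply/eqP; congr (B * _); congr (_%:R); apply: eq_card => D.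
  by rewrite !inE lt0n unfold_in /= andbAC andbA.
rewrite -(ler_nat R) in zero; apply: le_trans (lerD zero nonzero) _.
have two := two_powR_bound R (ltn0Sn n').
by rewrite -{1}[S%:R]mul1r -mulrDl ler_wpM2r.
Qed.

End UpperBound.

(** * The lower bound *)

Section CyclicBlocks.

Import VectorInternalTheory.

Variables (F : finFieldType).
Let q := #|F|.
Local Open Scope ring_scope.

Lemma card_finvect (L : vectType F) : #|finvect_type L| = (q ^ dim L)%N.
Proof.
rewrite -[dim L]mul1n -card_mx; apply: (@bij_eq_card (finvect_type L) 'rV[F]_(dim L) v2r).
by exists r2v; [exact: v2rK | exact: r2vK].
Qed.

Lemma field_extension_of_degree (i : nat) : (0 < i)%N ->
  exists L : splittingFieldType F, \dim {:L} = i.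
Proof.
move=> i0; have q1 : (1 < q)%N by apply: card_finNzRing_gt1.
have m_gt1 : (1 < q ^ i)%N by rewrite -(exp1n i) ltn_exp2r.
set m := (q ^ i)%N in m_gt1 *.
pose P (R : nzRingType) : {poly R} := 'X^m - 'X.
have DP R : P R = ('X^(m.-1) - 1) * ('X - 0).
  by rewrite subr0 mulrBl mul1r -exprSr prednK // ltnW.
have m1_gt0 : (0 < m.-1)%N by rewrite -ltnS prednK // ltnW.
have /FinSplittingFieldFor[/= L splitL] : P F != 0.
  by rewrite DP monic_neq0 ?rpredM ?monicXsubC ?monicXnsubC.
rewrite [map_poly _ _]rmorphB rmorphXn /= map_polyX -/(P L) in splitL.
exists L; have [p pp pF] := finPcharP F.
have pL : p \in [pchar L] by rewrite pchar_lalg.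
have [r qr] : exists r, q = (p ^ r)%N.
  by exists (logn p #|pPrimeCharType pF|); apply: card_pprimeChar.
have mL : m%:R = 0 :> L.
  have r0 : (0 < r * i)%N by move: m_gt1; rewrite /m qr -expnM; case: (r * i)%N.
  by apply/eqP; rewrite -(dvdn_pcharf pL) /m qr -expnM -(prednK r0) expnS dvdn_mulr.
pose Fm := FinFieldExtType L.
have /finField_galois_generator[/= a _ Da] : (1 <= {:L})%VS by apply: sub1v.
pose Em := fixedSpace (a ^+ i)%g; rewrite dimv1 expn1 in Da.
have {splitL} [zs DqL defL] := splitL.
have Uzs : uniq zs.
  rewrite -separable_prod_XsubC -(eqp_separable DqL) DP separable_root andbC.
  rewrite /root !hornerE subr_eq0 eq_sym expr0n gtn_eqF ?oner_eq0 //=.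
  rewrite cyclotomic.separable_Xn_sub_1 // -subn1 natrB ?(ltnW m_gt1) // mL sub0r.
  by rewrite oppr_eq0 oner_eq0.
have in_zs : zs =i Em.
  move=> z; rewrite -root_prod_XsubC -(eqp_root DqL) (sameP fixedSpaceP eqP).
  rewrite /root !hornerE subr_eq0 /= /m; congr (_ == z).
  elim: (i) => [|j IHj]; first by rewrite gal_id.
  by rewrite expgSr expnSr exprM IHj galM ?Da ?memvf.
have defEm : Em = {:L}%VS.
  apply/eqP; rewrite eqEsubv subvf -defL -[Em]subfield_closed agenvS //.
  by rewrite subv_add sub1v; apply/span_subvP=> z; rewrite in_zs.
have cardFm : #|Fm| = m.
  have /eq_card -> : Fm =i zs by move=> z; rewrite in_zs defEm memvf.
  apply: succn_inj; rewrite (card_uniqP _) //= -(size_prod_XsubC _ id).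
  by rewrite -(eqp_size DqL) size_polyDl size_polyXn // size_polyN size_polyX.
have := etrans (esym (card_finvect L)) cardFm.
by rewrite dimvf => /eqP; rewrite eqn_exp2l // => /eqP.
Qed.

(* Multiplication by an element of order e in the field with q ^ i elements. *)
Lemma cyclic_block (i e : nat) : (0 < i)%N -> (0 < e)%N -> (e %| q ^ i - 1)%N ->
  exists A : 'M[F]_i, forall k, \rank (kermx (A ^+ k - 1)) = (if e %| k then i else 0)%N.
Proof.
move=> i0 e0 ei; have [L dimL] := field_extension_of_degree i0.
have dL : dim L = i by rewrite -dimL dimvf.
pose Fm := FinFieldExtType L.
have cardL : #|Fm| = (q ^ i)%N by rewrite -dL -card_finvect.
have /cyclicP[g gE] := field_unit_group_cyclic [set: {unit Fm}]%G.
have og : #[g]%g = (q ^ i - 1)%N.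
  by rewrite orderE -gE card_finField_unit cardL subn1.
pose h := (g ^+ ((q ^ i - 1) %/ e))%g.
have oh : #[h]%g = e.
  have qi0 : (0 < q ^ i - 1)%N.
    by rewrite subn_gt0 -(exp1n i) ltn_exp2r // card_finNzRing_gt1.
  have d0 : (0 < (q ^ i - 1) %/ e)%N by rewrite divn_gt0 // dvdn_leq.
  rewrite orderXdiv og; last by rewrite -{2}(divnK ei) dvdn_mulr.
  by rewrite -{1}(divnK ei) mulKn.
pose w : L := FinRing.uval h.
have wk k : (w ^+ k == 1) = (e %| k)%N.
  rewrite -oh order_dvdn -(inj_eq val_inj) /= FinRing.val_unitX.
  by [].
pose f (v : 'rV[F]_(dim L)) : 'rV[F]_(dim L) := v2r (r2v v * w).
have f_lin : linear f.
  by move=> a u v; rewrite /f linearP mulrDl -scalerAl linearP.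
pose fL : {linear 'rV[F]_(dim L) -> 'rV[F]_(dim L)} :=
  HB.pack f (GRing.isLinear.Build F _ _ _ f f_lin).
pose B := lin1_mx fL.
have BX k v : v *m B ^+ k = v2r (r2v v * w ^+ k).
  elim: k v => [|k IH] v; first by rewrite !expr0 mulmx1 mulr1 r2vK.
  by rewrite !exprS -mulmxE mulmxA mul_rV_lin1 IH /= /f v2rK mulrA.
suff [A hA] : exists A : 'M[F]_(dim L),
    forall k, \rank (kermx (A ^+ k - 1)) = (if e %| k then dim L else 0)%N.
  by rewrite -dL; exists A.
exists B => k; rewrite -wk; case: eqP => [wk1|/eqP wk1].
  have -> : B ^+ k - 1 = 0.
    apply/row_matrixP=> j; rewrite row0 rowE mulmxBr mulmx1 BX wk1 mulr1 r2vK.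
    by rewrite subrr.
  by rewrite kermx0 mxrank1.
apply/eqP; rewrite mxrank_eq0; apply/rowV0P=> v /sub_kermxP.
rewrite mulmxBr mulmx1 BX => /eqP; rewrite subr_eq0 => /eqP/(congr1 r2v).
rewrite v2rK => /eqP; rewrite -[X in _ == X]mulr1 -subr_eq0 -mulrBr mulf_eq0 subr_eq0.
rewrite (negPf wk1) orbF => /eqP v0.
by rewrite -[v]r2vK v0 linear0.
Qed.

Lemma block_diag_exp (m n k : nat) (A : 'M[F]_m) (B : 'M[F]_n) :
  (block_mx A 0 0 B) ^+ k = block_mx (A ^+ k) 0 0 (B ^+ k).
Proof.
elim: k => [|k IH]; first by rewrite !expr0 -[1]/(1%:M) scalar_mx_block.
rewrite !exprS IH -!mulmxE mulmx_block.
by rewrite !mulmx0 !mul0mx !addr0 !add0r.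
Qed.

Lemma kermx_block_diag_rank (m n k : nat) (A : 'M[F]_m) (B : 'M[F]_n) :
  \rank (kermx ((block_mx A 0 0 B) ^+ k - 1))
    = (\rank (kermx (A ^+ k - 1)) + \rank (kermx (B ^+ k - 1)))%N.
Proof.
have -> : (block_mx A 0 0 B) ^+ k - 1 = block_mx (A ^+ k - 1) 0 0 (B ^+ k - 1).
  rewrite block_diag_exp -[X in _ - X]/(1%:M) scalar_mx_block opp_block_mx add_block_mx.
  by rewrite !oppr0 !addr0.
rewrite !mxrank_ker rank_diag_block_mx.
by have := rank_leq_row (A ^+ k - 1); have := rank_leq_row (B ^+ k - 1); lia.
Qed.

(* The pairs (i, e) list the sizes and the orders of the blocks. *)
Lemma matrix_with_blocks (s : seq (nat * nat)) (n : nat) :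
    all (fun p => [&& 0 < p.1, 0 < p.2 & p.2 %| q ^ p.1 - 1])%N s ->
    (\sum_(p <- s) p.1 <= n)%N ->
  exists A : 'M[F]_n, forall k, (0 < k)%N ->
    \rank (kermx (A ^+ k - 1)) = (\sum_(p <- s | p.2 %| k) p.1)%N.
Proof.
elim: s n => [|[i e] s IH] n /=.
  move=> _ _; exists 0 => k k0; rewrite big_nil expr0n eqn0Ngt k0 sub0r.
  apply/eqP; rewrite mxrank_eq0; apply/rowV0P=> v /sub_kermxP.
  by rewrite mulmxN mulmx1 => /eqP; rewrite oppr_eq0 => /eqP.
case/andP=> /and3P[i0 e0 ei] alls; rewrite big_cons /= => le_n.
have le_i : (i <= n)%N by apply: leq_trans le_n; exact: leq_addr.
rewrite -(subnKC le_i) leq_add2l in le_n *.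
have [B hB] := IH _ alls le_n; have [A hA] := cyclic_block i0 e0 ei.
exists (block_mx A 0 0 B) => k k0; rewrite kermx_block_diag_rank hA hB // big_cons /=.
by case: ifP.
Qed.

End CyclicBlocks.

Section LowerBound.

Variables (F : finFieldType) (n : nat).
Let q := #|F|.
Let mults : finType := {ffun 'I_n -> {ffun 'I_(q ^ n) -> 'I_n.+1}}.

Lemma is_mult_order_uniq e i j : is_mult_order e q i -> is_mult_order e q j -> i = j.
Proof.
wlog lij : i j / i <= j => [wl hi hj|].
  by case/orP: (leq_total i j) => /wl; [apply | move=> h; apply/esym/h].
move=> /and3P[i0 qi _] /and3P[_ _ /forallP minj]; apply/eqP; rewrite eqn_leq lij leqNgt.
by apply/negP=> ltij; have := minj (Ordinal ltij); rewrite /= i0 qi.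
Qed.

Definition order_support (i : 'I_n) : {set 'I_(q ^ n)} :=
  [set e : 'I_(q ^ n) | (0 < e) && is_mult_order e q i.+1].

Lemma card_order_support (i : 'I_n) : #|order_support i| = sigma_star q i.+1.
Proof.
have q1 : 1 < q by apply: card_finNzRing_gt1.
have le_qi : q ^ i.+1 <= q ^ n by rewrite leq_exp2l.
have winj : injective (widen_ord le_qi) by move=> a b /(congr1 val) /= /val_inj.
rewrite /sigma_star -(card_imset _ winj); apply: eq_card => e; apply/idP/imsetP.
  rewrite inE => /andP[e0 ei]; exists (Ordinal (is_mult_order_lt q1 ei)).
    by rewrite inE e0.
  exact: val_inj.
by case=> d; rewrite !inE => hd ->.
Qed.

Definition fixed_count (D : mults) (k : nat) : nat :=
  \sum_(e < q ^ n | e %| k) \sum_(i < n) D i e * i.+1.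

Lemma matrix_of_multiplicities (D : mults) :
    supported order_support D -> weight D <= n ->
  exists A : 'M[F]_n, forall k, 0 < k -> (\rank (kermx (A ^+ k - 1)%R)) = fixed_count D k.
Proof.
move=> sD wD; pose blk (t : 'I_n * 'I_(q ^ n)) := (t.1.+1, val t.2).
pose s := flatten [seq nseq (D t.1 t.2) (blk t) | t <- enum {: 'I_n * 'I_(q ^ n)}].
have q0 : 0 < q by rewrite ltnW // card_finNzRing_gt1.
have sumS (P : pred (nat * nat)) :
    \sum_(t <- s | P t) t.1 = \sum_(i < n) \sum_(e < q ^ n | P (i.+1, val e)) D i e * i.+1.
  rewrite /s big_flatten big_map big_enum /= pair_big_dep /= big_mkcond [RHS]big_mkcond /=.
  apply: eq_bigr => -[i e] _ /=; rewrite big_nseq_cond /=; case: ifP => // _.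
  by rewrite iter_addn_0 mulnC.
have alls : all (fun t => [&& 0 < t.1, 0 < t.2 & t.2 %| q ^ t.1 - 1]) s.
  apply/allP=> t /flattenP[b /mapP[[i e] _ ->]] /=.
  rewrite mem_nseq => /andP[De /eqP ->] /=.
  have := sD => /forallP/(_ i)/forallP/(_ e); rewrite inE.
  have -> : D i e == ord0 = false by rewrite -val_eqE /= gtn_eqF.
  by rewrite implybF negbK => /andP[-> /and3P[_ qi _]]; rewrite -eqn_mod_dvd ?expn_gt0 ?q0.
have ws : \sum_(t <- s) t.1 <= n by rewrite sumS.
have [A hA] := matrix_with_blocks alls ws.
by exists A => k k0; rewrite hA // sumS /fixed_count exchange_big.
Qed.

Lemma fixed_count_inj (D D' : mults) :
    supported order_support D -> supported order_support D' ->
    (forall k, 0 < k -> fixed_count D k = fixed_count D' k) ->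
  D = D'.
Proof.
move=> sD sD' eq_fix; pose m (D : mults) (e : 'I_(q ^ n)) := \sum_(i < n) D i e * i.+1.
have zero (E : mults) i e : supported order_support E ->
    e \notin order_support i -> E i e = ord0.
  by move=> /forallP/(_ i)/forallP/(_ e)/implyP h /h/eqP.
have eq_m (e : 'I_(q ^ n)) : 0 < e -> m D e = m D' e.
  have [b] := ubnP (e : nat); elim: b e => // b IH e le_e e0.
  have := eq_fix _ e0; rewrite /fixed_count (bigD1 e) //= [RHS](bigD1 e) //= -/(m D e) -/(m D' e).
  set r := (X in m D e + X); set r' := (X in _ = m D' e + X).
  suff -> : r = r' by move/addIn.
  apply: eq_bigr => d /andP[de ne]; apply: IH; last exact: dvdn_gt0 de.
  have : d <= e by rewrite dvdn_leq.
  rewrite leq_eqVlt (negPf (_ : val d != val e)) //=.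
  by move=> lt; apply: leq_trans lt _; rewrite -ltnS.
apply/ffunP=> i; apply/ffunP=> e.
case: (boolP (e \in order_support i)) => ei; last by rewrite !(zero _ _ _ _ ei).
have mE (E : mults) : supported order_support E -> m E e = E i e * i.+1.
  move=> sE; rewrite /m (bigD1 i) //= big1 ?addn0 // => j ji.
  rewrite (zero E) //; apply: contra ji; move: ei; rewrite !inE => /andP[_ ei] /andP[_ ej].
  by apply/eqP/val_inj; have [] := is_mult_order_uniq ej ei.
have e0 : 0 < e by move: ei; rewrite inE => /andP[].
have := eq_m e e0; rewrite !mE // => /eqP; rewrite eqn_pmul2r // => /eqP.
exact: val_inj.
Qed.

Lemma num_linear_graphs_lower :
  \sum_(l in weight_vectors n) \prod_(i < n) 'C(sigma_star q i.+1 + l i - 1, l i)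
    <= num_linear_graphs F n.
Proof.
have -> : \sum_(l in weight_vectors n) \prod_(i < n) 'C(sigma_star q i.+1 + l i - 1, l i)
    = #|nonzero_supported order_support|.
  rewrite -sum_weight_vectors; apply: eq_bigr => l _; apply: eq_bigr => i _.
  by rewrite card_order_support.
pose P (D : mults) (A : 'M[F]_n) :=
  forall k, 0 < k -> (\rank (kermx (A ^+ k - 1)%R)) = fixed_count D k.
have exA D : exists A, D \in nonzero_supported order_support -> P D A.
  case: (boolP (D \in _)) => [|_]; last by exists 0%R.
  by rewrite inE => /and3P[sD _ wD]; have [A hA] := matrix_of_multiplicities sD wD; exists A.
have [h hP] := choice exA.
rewrite /num_linear_graphs; apply: (@leq_card_equivalence_partition _ (@digraph_iso 'rV[F]_n)
  (linear_graphs F n) (@digraph_iso_equiv _) mults (nonzero_supported order_support)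
  (fun D => matrix_graph (h D))) => [D DS|D D' DS D'S].
  by apply/linear_graphsP; exists (h D).
case/functional_graph_iso=> s sP.
have iterP k v : s (iter k (mulmxr (h D)) v) = iter k (mulmxr (h D')) (s v).
  by elim: k => // k IH; rewrite !iterS -IH -sP.
move: (DS) (D'S); rewrite !inE => /and3P[sD _ _] /and3P[sD' _ _].
apply: fixed_count_inj => // k k0; rewrite -(hP D) // -(hP D') //.
apply: (@expnI q); first exact: card_finNzRing_gt1.
rewrite -!card_fixed -(card_imset _ (@perm_inj _ s)); apply: eq_card => v.
rewrite !inE; apply/imsetP/eqP => [[u]|vk].
  by rewrite inE => /eqP uk ->; rewrite -iterP uk.
exists (s^-1%g v); last by rewrite permKV.
by rewrite inE; apply/eqP/(@perm_inj _ s); rewrite iterP permKV.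
Qed.

End LowerBound.

Theorem theorem1 (R : realType) (q : nat) (F : finFieldType) (hF : #|F| = q)
    (n : nat) (hn : 0 < n) :
  \sum_(l in weight_vectors n)
     \prod_(i < n) 'C(sigma_star q i.+1 + l i - 1, l i)
    <= num_linear_graphs F n
  /\ ((num_linear_graphs F n)%:R <=
      (2 : R) `^ (4 * Num.sqrt (n%:R : R)) *
      (\sum_(l in weight_vectors n)
         \prod_(i < n) 'C(sigma q i.+1 + l i - 1, l i))%N%:R)%R.
Proof.
move: hn; rewrite -hF; case: n => // n' _; split.
  exact: num_linear_graphs_lower.
exact: num_linear_graphs_upper.
Qed.
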